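(* There are, up to homotopy, exactly $1, 0, 0, 2, 26$ virtual strings with minimal crossing number $0,1,2,3,4$ respectively. More precisely, the following $29$ nanowords represent pairwise distinct virtual strings, and every virtual string of minimal crossing number at most $4$ is represented by one of them. Minimal crossing number $0$: the empty nanoword. Minimal crossing number $3$: $ABACBC{:}aab$, $ABACBC{:}abb$. Minimal crossing number $4$: $ABABCDCD{:}t$ for $t\in\{aaaa,\ aabb,\ bbbb\}$; $ABACBDCD{:}t$ for $t\in\{aaaa,\ aaab,\ aaba,\ abaa,\ abab,\ abba,\ abbb,\ baaa,\ baab,\ baba,\ babb,\ bbab,\ bbba,\ bbbb\}$; $ABACDBCD{:}t$ for $t\in\{aabb,\ abbb,\ baaa,\ bbaa\}$; $ABACDBDC{:}t$ for $t\in\{aabb,\ abbb\}$; $ABCADBCD{:}t$ for $t\in\{aaab,\ abbb\}$; $ABCADCBD{:}aaab$.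
   Context: A Gauss word is a finite sequence of letters in which each letter that appears, appears exactly twice. A nanoword is a pair $(w,\pi)$ where $w$ is a Gauss word and $\pi$ is a map from the set of letters appearing in $w$ to $\{a,b\}$; $\pi(X)$ is called the type of $X$. The nanoword is written $w{:}t$, where $t$ is the sequence of types of the letters of $w$, listed in alphabetical order of the letters. The empty Gauss word gives the empty nanoword. An isomorphism of nanowords is a bijective relabelling of letters carrying the $n$th letter of the first word to the $n$th letter of the second word for all $n$ and preserving types. Moves (upper case letters are single letters, lower case letters are arbitrary, possibly empty, sequences of letters such that both sides are Gauss words; letters not mentioned keep their types): Shift move: $AxAy \leftrightarrow xByB$, where $A$ and $B$ have opposite types. H1: $xAAy\leftrightarrow xy$, where $A$ has any type. H2: $xAByBAz\leftrightarrow xyz$, where $A$ and $B$ have opposite types. H3: $xAByACzBCt\leftrightarrow xBAyCAzCBt$, where $A,B,C$ all have the same type (types are unchanged by the move). Two nanowords are homotopic if they are related by a finite sequence of isomorphisms, shift moves, and moves H1, H2, H3 and their inverses. A virtual string is a homotopy class of nanowords. (Equivalently, by a theorem of Turaev, virtual strings are equivalence classes of generic immersions of an oriented circle in compact oriented surfaces, under stable homeomorphism and flattened Reidemeister moves, the letters of a nanoword corresponding to the double points of the immersed curve.) The minimal crossing number of a virtual string is the minimum number of distinct letters in a nanoword representing it. *)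

(* Defs.v *)
From Stdlib Require Import Ascii String.
From Stdlib Require Import Relation_Operators.
From mathcomp Require Import all_boot.
From mathcomp Require Import boolp classical_sets functions cardinality.

Set Implicit Arguments.
Unset Strict Implicit.
Unset Printing Implicit Defensive.

Local Open Scope classical_set_scope.

(* Letters are natural numbers; their alphabetical order is [leq]. *)
Definition letter := nat.

Inductive ltype := type_a | type_b.

Definition opposite (t : ltype) : ltype :=
  match t with type_a => type_b | type_b => type_a end.

Definition gauss_word (w : seq letter) : bool :=
  all (fun X => count_mem X w == 2) w.

(* [nw_type] is only meaningful on the letters of [nw_word]: every move below
   reads it only there, and [Isomorphism] with the identity relabelling
   identifies nanowords that differ only off their letters. *)
Record nanoword := Nanoword {
  nw_word : seq letter;
  nw_type : letter -> ltype;
  nw_gauss : gauss_word nw_word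
}.

Definition crossings (n : nanoword) : nat := size (undup (nw_word n)).

(* Both ends are nanowords, so both words are Gauss words; hence letters
   introduced by a move are fresh, and the letters named in H2 and H3 are
   pairwise distinct.  In [Shift], [B] may carry the same name as [A]. *)
Inductive move (m n : nanoword) : Prop :=
| Isomorphism (f : letter -> letter) of
    {in nw_word m &, injective f} &
    nw_word n = map f (nw_word m) &
    {in nw_word m, forall X, nw_type n (f X) = nw_type m X}
| Shift (A B : letter) (x y : seq letter) of
    nw_word m = [:: A] ++ x ++ [:: A] ++ y &
    nw_word n = x ++ [:: B] ++ y ++ [:: B] &
    nw_type n B = opposite (nw_type m A) &
    {in x ++ y, nw_type n =1 nw_type m}
| H1 (A : letter) (x y : seq letter) of
    nw_word m = x ++ [:: A; A] ++ y &
    nw_word n = x ++ y &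
    {in x ++ y, nw_type n =1 nw_type m}
| H2 (A B : letter) (x y z : seq letter) of
    nw_word m = x ++ [:: A; B] ++ y ++ [:: B; A] ++ z &
    nw_word n = x ++ y ++ z &
    nw_type m B = opposite (nw_type m A) &
    {in x ++ y ++ z, nw_type n =1 nw_type m}
| H3 (A B C : letter) (x y z t : seq letter) of
    nw_word m = x ++ [:: A; B] ++ y ++ [:: A; C] ++ z ++ [:: B; C] ++ t &
    nw_word n = x ++ [:: B; A] ++ y ++ [:: C; A] ++ z ++ [:: C; B] ++ t &
    nw_type m A = nw_type m B &
    nw_type m B = nw_type m C &
    {in nw_word m, nw_type n =1 nw_type m}.

Definition homotopic : nanoword -> nanoword -> Prop :=
  clos_refl_sym_trans nanoword move.

Definition homotopy_class (n : nanoword) : set nanoword :=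
  [set m | homotopic n m].

Definition virtual_string : set (set nanoword) := range homotopy_class.

Definition min_crossing_number (V : set nanoword) (k : nat) : Prop :=
  (exists2 n, V n & crossings n = k) /\ (forall n, V n -> k <= crossings n).

Definition virtual_strings_of_crossing_number (k : nat) : set (set nanoword) :=
  [set V | virtual_string V /\ min_crossing_number V k].

(* The notation w:t, for a word and a list of types given by strings. *)

Definition letters_of (s : String.string) : seq letter :=
  map Ascii.nat_of_ascii (String.list_ascii_of_string s).

Definition types_of (s : String.string) : seq ltype :=
  map (fun c => if Ascii.eqb c "a"%char then type_a else type_b)
      (String.list_ascii_of_string s).

(* The i-th type in [ts] goes to the i-th letter of [w] in alphabetical order. *)
Definition assign_types (w : seq letter) (ts : seq ltype) (X : letter) : ltype :=
  nth type_a ts (index X (sort leq (undup w))).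

Notation "w :t: t" :=
  (@Nanoword (letters_of w%string)
     (assign_types (letters_of w%string) (types_of t%string)) isT)
  (at level 50, no associativity, only parsing).

Definition tabulated (k : nat) : seq nanoword :=
  match k with
  | 0 => [:: "" :t: ""]
  | 3 => [:: "ABACBC" :t: "aab"; "ABACBC" :t: "abb"]
  | 4 =>
    [:: "ABABCDCD" :t: "aaaa"; "ABABCDCD" :t: "aabb"; "ABABCDCD" :t: "bbbb";
        "ABACBDCD" :t: "aaaa"; "ABACBDCD" :t: "aaab"; "ABACBDCD" :t: "aaba";
        "ABACBDCD" :t: "abaa"; "ABACBDCD" :t: "abab"; "ABACBDCD" :t: "abba";
        "ABACBDCD" :t: "abbb"; "ABACBDCD" :t: "baaa"; "ABACBDCD" :t: "baab";
        "ABACBDCD" :t: "baba"; "ABACBDCD" :t: "babb"; "ABACBDCD" :t: "bbab";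
        "ABACBDCD" :t: "bbba"; "ABACBDCD" :t: "bbbb";
        "ABACDBCD" :t: "aabb"; "ABACDBCD" :t: "abbb"; "ABACDBCD" :t: "baaa";
        "ABACDBCD" :t: "bbaa";
        "ABACDBDC" :t: "aabb"; "ABACDBDC" :t: "abbb";
        "ABCADBCD" :t: "aaab"; "ABCADBCD" :t: "abbb";
        "ABCADCBD" :t: "aaab"]
  | _ => [::]
  end.

Definition table : seq nanoword := flatten (map tabulated (iota 0 5)).

(* Main.v *)
Require Import Defs.
From Stdlib Require Import List ZArith.
From Stdlib Require Import Relation_Operators.
From mathcomp Require Import all_boot.
From mathcomp Require Import zify ssrZ.
From mathcomp Require Import boolp classical_sets functions cardinality.

(** A nanoword is a circle with arrows, one for each letter, and a shift move only
    moves the base point.  The theorem has two halves.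

    No string is missing ([homotopic_table]).  A word with at most four letters either
    is, up to rotation and renaming, in the table, or loses letters by H1, by H2 or
    by the derived move [homotopic_parallel] that removes a pair of letters whose
    strands run in the same direction, if necessary after one H3 move.  This is checked
    by computation on all words with at most four letters ([codes_complete],
    [codes_checked]), and induction on the number of letters ends in the table,
    without ever increasing the number of letters of the representative.

    No string is listed twice ([table_separated]).  Each letter [A] cuts the circle into
    two arcs, and recording on which arc every other occurrence lies gives Turaev's
    index [idx A] of the arrow and the intersection numbers [inter A B] of the
    loops based at the crossings.  H3 preserves them all; H1 adds a letter of index
    zero; H2 adds two letters whose indices and intersection numbers are opposite.
    A sum over all letters of an expression that vanishes for index zero and is odd
    under this change of sign is therefore invariant ([refined_invariant]).  Three
    such sums distinguish the tabulated strings up to a few coincidences.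

    The remaining coincidences are resolved by a sum over pairs of unlinked arrows.
    In a triangle of H3, the loop at one crossing is the sum of the loops at the other
    two, and the move replaces one unlinked pair by the other two pairs.  A weight on
    pairs of indices whose sum over the three pairs of a zero-sum triple vanishes is
    thus not affected by H3 ([pairing_invariant]).

    The four integers so obtained are different for all 29 entries of the table
    ([invariants_uniq]).  Together with the first half this determines the minimal
    crossing numbers of the entries, and hence the number of strings for each. *)

Set Implicit Arguments.
Unset Strict Implicit.
Unset Printing Implicit Defensive.

(** * Signed codes *)

(** A cyclic word in which each letter occurs once with each sign: the positive
    occurrence of a letter is its first one if the letter has type [a] and its
    second one if it has type [b].  A letter is thus an arrow on the circle, and
    a shift move, which flips the type of the letter that it carries around,
    becomes a plain rotation. *)
Definition code := seq (letter * bool).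

Definition unsign : code -> seq letter := map fst.

Definition wf (c : code) : bool := uniq c && gauss_word (unsign c).

Lemma mem_unsign c X : (X \in unsign c) = ((X, true) \in c) || ((X, false) \in c).
Proof.
apply/mapP/orP => [[[Y s] + /= ->]|[]]; last 2 first.
- by exists (X, true).
- by exists (X, false).
by case: s; [left|right].
Qed.

Lemma unsign_mem c X s : (X, s) \in c -> X \in unsign c.
Proof. by move=> /(map_f fst). Qed.

(** In a duplicate-free code a letter occurs once for each sign present, which is
    what makes the Gauss condition equivalent to closure under sign change. *)
Lemma count_unsign c X : uniq c ->
  count_mem X (unsign c) = ((X, true) \in c) + ((X, false) \in c).
Proof.
move=> Uc; rewrite -!(count_uniq_mem _ Uc) count_map; elim: c {Uc} => //= -[Y s] c ->.
by rewrite -!pair_eqE /= /pair_eq /=; case: (Y == X); case: s => //=; lia.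
Qed.

Lemma wf_uniq c : wf c -> uniq c.
Proof. by case/andP. Qed.

Lemma wf_signs c X s : wf c -> X \in unsign c -> (X, s) \in c.
Proof.
case/andP=> Uc /allP G /[dup] /G /eqP; rewrite count_unsign //.
by case: s; do 2!case: (_ \in c).
Qed.

Lemma wf_mem c X s : wf c -> ((X, s) \in c) = (X \in unsign c).
Proof. by move=> Wc; apply/idP/idP => [/unsign_mem //|/wf_signs]; apply. Qed.

Lemma wfP c : reflect (uniq c /\ forall X s, (X, s) \in c -> (X, ~~ s) \in c) (wf c).
Proof.
apply: (iffP idP) => [Wc|[Uc Sc]].
  by split=> [|X s]; [exact: wf_uniq | rewrite !wf_mem].
rewrite /wf Uc; apply/allP => X; rewrite count_unsign // mem_unsign.
by case/orP=> H; have := Sc _ _ H; rewrite /= H => ->.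
Qed.

Lemma wf_perm c d : perm_eq c d -> wf c -> wf d.
Proof.
move=> P /wfP[Uc Sc]; apply/wfP; rewrite -(perm_uniq P); split=> // X s.
by rewrite -!(perm_mem P); apply: Sc.
Qed.

Lemma wf_cons2 A s c : wf [:: (A, s), (A, ~~ s) & c] = (A \notin unsign c) && wf c.
Proof.
apply/idP/andP => [W|[nA W]].
  have U := wf_uniq W; move: U => /=; rewrite inE negb_or => /and3P[/andP[_ n1] n2 U].
  split; first by rewrite mem_unsign negb_or; case: s n1 n2 {W} => /= -> ->.
  apply/wfP; split=> // X t Xt; have: (X, ~~ t) \in [:: (A, s), (A, ~~ s) & c].
    by rewrite wf_mem //= !inE (unsign_mem Xt) !orbT.
  rewrite !inE => /or3P[/eqP[E1 E2]|/eqP[E1 E2]|//].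
    by rewrite -E2 negbK in n2; rewrite -E1 Xt in n2.
  by rewrite -(negb_inj E2) -E1 Xt in n1.
have nAs b : (A, b) \notin c by apply: contra nA => /unsign_mem.
apply/wfP; rewrite /= inE negb_or !nAs (wf_uniq W) xpair_eqE eqxx /=.
split=> [|X t]; first by case: (s).
rewrite !inE => /or3P[/eqP[-> ->]|/eqP[-> ->]|Xt]; rewrite ?negbK ?eqxx ?orbT //.
by rewrite !wf_mem // in Xt *; rewrite Xt !orbT.
Qed.

(** The value [true] on absent letters is a dummy. *)
Fixpoint first_sign (c : code) (X : letter) : bool :=
  if c is p :: c' then if p.1 == X then p.2 else first_sign c' X else true.

Lemma first_sign_cat c d X :
  first_sign (c ++ d) X = if X \in unsign c then first_sign c X else first_sign d X.
Proof. by elim: c => //= p c ->; rewrite in_cons (eq_sym X); case: eqP. Qed.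

Lemma first_sign_mem c X : X \in unsign c -> (X, first_sign c X) \in c.
Proof.
elim: c => //= -[Y s] c IH; rewrite !in_cons /= (eq_sym X).
by case: (eqVneq Y X) => [->|_] /=; rewrite ?eqxx // => /IH ->; rewrite orbT.
Qed.

Lemma first_sign_before c d X s : uniq (c ++ d) -> (X, s) \in c -> (X, ~~ s) \in d ->
  first_sign (c ++ d) X = s.
Proof.
rewrite cat_uniq => /and3P[_ /hasPn D _] Xc Xd; rewrite first_sign_cat (unsign_mem Xc).
have := first_sign_mem (unsign_mem Xc); have := D _ Xd.
by case: s {Xc Xd}; case: (first_sign c X) => // /negP.
Qed.

Definition is_a (t : ltype) : bool := if t is type_a then true else false.
Definition of_sign (s : bool) : ltype := if s then type_a else type_b.

Lemma of_signK : cancel of_sign is_a. Proof. by case. Qed.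
Lemma is_aK : cancel is_a of_sign. Proof. by case. Qed.
Lemma of_signN s : of_sign (~~ s) = opposite (of_sign s). Proof. by case: s. Qed.

(** An occurrence of [X] in a Gauss word is the first one exactly when [X] still
    occurs to its right. *)
Fixpoint signs (w : seq letter) (t : letter -> ltype) : code :=
  if w is X :: w' then (X, (X \in w') == is_a (t X)) :: signs w' t else [::].

Lemma unsign_signs w t : unsign (signs w t) = w.
Proof. by elim: w => //= X w ->. Qed.

Lemma signs_last w t X s : count_mem X w <= 1 -> (X, s) \in signs w t ->
  s = ~~ is_a (t X).
Proof.
elim: w => //= Y w IH; rewrite in_cons; case: (eqVneq Y X) => [->|nYX] /=; last first.
  by move=> /IH H /orP[/eqP[E]|//]; rewrite E eqxx in nYX.
rewrite add1n ltnS leqn0 => /eqP C.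
have nX : X \notin w by rewrite -has_pred1 has_count C.
case/orP=> [/eqP[->]|/unsign_mem H]; last by rewrite unsign_signs (negPf nX) in H.
by rewrite (negPf nX); case: is_a.
Qed.

Lemma first_sign_signs w t X : count_mem X w = 2 -> first_sign (signs w t) X = is_a (t X).
Proof.
elim: w => //= Y w IH; case: (eqVneq Y X) => [->|_] /=; last by move=> /IH.
by rewrite add1n => -[C]; rewrite -has_pred1 has_count C.
Qed.

Lemma wf_signs_gauss w t : gauss_word w -> wf (signs w t).
Proof.
move=> Gw; rewrite /wf unsign_signs Gw andbT.
have: forall X, count_mem X w <= 2.
  move=> X; case: (boolP (X \in w)) => [/(allP Gw)/eqP -> //|].
  by rewrite -has_pred1 has_count -leqNgt leqn0 => /eqP ->.
elim: w {Gw} => //= Y w IH C; rewrite IH ?andbT; last first.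
  by move=> X; apply: leq_trans (C X); rewrite leq_addl.
have {}C: count_mem Y w <= 1 by have := C Y; rewrite eqxx.
apply/negP => /[dup] /(signs_last C) E /unsign_mem; rewrite unsign_signs => Yw.
by rewrite Yw in E; case: is_a E.
Qed.

Lemma signs_unsign c t : wf c -> {in unsign c, forall X, is_a (t X) = first_sign c X} ->
  signs (unsign c) t = c.
Proof.
suff: forall p q, wf (p ++ q) -> {in unsign q, forall X, is_a (t X) = first_sign (p ++ q) X} ->
  signs (unsign q) t = q by move=> H; apply: (H [::]).
move=> {c} p q; elim: q p => //= -[X s] q IH p W Ht.
have {}IH: signs (unsign q) t = q.
  apply: (IH (rcons p (X, s))); rewrite cat_rcons // => Y Yq.
  by apply: Ht; rewrite in_cons Yq orbT.
rewrite /= IH (Ht X (mem_head _ _)); congr ((_, _) :: _).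
have U := wf_uniq W.
have: (X, ~~ s) \in p ++ (X, s) :: q.
  by rewrite wf_mem // (@unsign_mem _ _ s) // mem_cat mem_head orbT.
have nXq : (X, s) \notin q by move: U; rewrite cat_uniq /= => /and3P[_ _ /andP[]].
have ns : (~~ s == s) = false by case: (s).
rewrite mem_cat in_cons xpair_eqE eqxx ns /=; case/orP=> [Xp|Xq].
  rewrite (first_sign_before U Xp) ?negbK ?mem_head //.
  have: X \notin unsign q; last by move/negPf->; case: (s).
  move: U; rewrite cat_uniq => /and3P[_ /hasPn D _]; rewrite mem_unsign.
  have: (X, ~~ s) \notin q.
    by apply/negP => Xq; have := D (X, ~~ s); rewrite in_cons Xq orbT Xp => /(_ isT).
  by case: s nXq {W Xp D Ht ns} => /= /negPf -> /negPf ->.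
rewrite (unsign_mem Xq) -cat_rcons (@first_sign_before _ _ _ s) ?cat_rcons //.
by rewrite mem_rcons mem_head.
Qed.

(** Two codes with explicit entries are permutations of each other if every predicate
    has the same count on both. *)
Ltac by_perm :=
  apply/seq.permP => ?;
  rewrite /= -?cats1 ?count_cat /= ?count_cat /= ?count_cat /= ?count_cat /=;
  clear; lia.

(** Used with a permutation that brings the four occurrences of the two letters of
    an H2 move to the front. *)
Lemma wf_cons4 A s B t c : wf [:: (A, s), (A, ~~ s), (B, t), (B, ~~ t) & c] =
  [&& A != B, A \notin unsign c, B \notin unsign c & wf c].
Proof. by rewrite !wf_cons2 /= !in_cons !negb_or; case: (A == B) => //=. Qed.

(** The first sign of [X] only depends on the occurrences of [X]; a move is then
    seen not to change it by filtering both codes. *)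
Lemma first_sign_filter c X : first_sign c X = first_sign [seq p <- c | p.1 == X] X.
Proof. by elim: c => //= p c IH; case E: (p.1 == X) => //=; rewrite E. Qed.

Lemma uniq_sign (p q : code) A s s' : uniq (p ++ (A, s) :: q) -> (A, s') \in q -> s' = ~~ s.
Proof.
rewrite cat_uniq => /and3P[_ _ /andP[/negP + _]] Aq.
by case: (eqVneq s s') Aq => [<- //|+ _ _]; case: s; case: s'.
Qed.

Lemma unsign_cat c x y : unsign c = x ++ y ->
  exists cx cy, [/\ c = cx ++ cy, unsign cx = x & unsign cy = y].
Proof.
move=> E; exists (take (size x) c), (drop (size x) c); rewrite cat_take_drop.
by split=> //; rewrite /unsign (map_take, map_drop) -/(unsign c) E (take_size_cat, drop_size_cat).
Qed.

Lemma unsign_cons c X y : unsign c = X :: y -> exists s d, c = (X, s) :: d /\ unsign d = y.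
Proof. by case: c => [//|[Y s] c] /= [-> <-]; exists s, c. Qed.

(** * Nanowords and their codes *)

Definition code_of (n : nanoword) : code := signs (nw_word n) (nw_type n).

Lemma unsign_code_of n : unsign (code_of n) = nw_word n.
Proof. exact: unsign_signs. Qed.

Lemma wf_code_of n : wf (code_of n).
Proof. by apply: wf_signs_gauss; apply: nw_gauss. Qed.

Lemma nw_type_code_of n X : X \in nw_word n -> nw_type n X = of_sign (first_sign (code_of n) X).
Proof.
move=> Xn; rewrite first_sign_signs ?is_aK //.
by apply/eqP; apply: (allP (nw_gauss n)).
Qed.

(** A code is determined by its word and by its first signs. *)
Lemma code_of_eq n c : wf c -> unsign c = nw_word n ->
  {in nw_word n, forall X, nw_type n X = of_sign (first_sign c X)} -> code_of n = c.
Proof.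
move=> W E H; rewrite /code_of -E signs_unsign // => X; rewrite E => /H ->.
exact: of_signK.
Qed.

Definition empty_nanoword := @Nanoword [::] (fun=> type_a) isT.

(** The empty nanoword is a dummy value for codes that are not well formed. *)
Definition nano (c : code) : nanoword :=
  if @idP (gauss_word (unsign c)) is ReflectT G
  then Nanoword (fun X => of_sign (first_sign c X)) G else empty_nanoword.

Lemma nw_word_nano c : wf c -> nw_word (nano c) = unsign c.
Proof. by case/andP=> _; rewrite /nano; case: {-}_ / idP. Qed.

Lemma nw_type_nano c X : wf c -> nw_type (nano c) X = of_sign (first_sign c X).
Proof. by case/andP=> _; rewrite /nano; case: {-}_ / idP. Qed.

Lemma homotopic_code_eq m n : code_of m = code_of n -> homotopic m n.
Proof.
move=> E; apply: rst_step; have Ew : nw_word n = nw_word m by rewrite -!unsign_code_of E.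
apply: (@Isomorphism _ _ id); rewrite ?map_id // => X Xm.
by rewrite !nw_type_code_of ?Ew // E.
Qed.

Lemma code_of_nano c : wf c -> code_of (nano c) = c.
Proof.
by move=> W; apply: code_of_eq; rewrite ?nw_word_nano // => X _; rewrite nw_type_nano.
Qed.

Definition relabel (f : letter -> letter) (c : code) : code := [seq (f p.1, p.2) | p <- c].

Lemma unsign_relabel f c : unsign (relabel f c) = map f (unsign c).
Proof. by rewrite /unsign -!map_comp. Qed.

Lemma wf_relabel f c : {in unsign c &, injective f} -> wf c -> wf (relabel f c).
Proof.
move=> If /wfP[Uc Sc]; apply/wfP; split.
  rewrite map_inj_in_uniq // => -[X s] [Y t] /unsign_mem Xc /unsign_mem Yc [E ->].
  by rewrite (If X Y).
by move=> Y t /mapP[[X s] /Sc Xc [-> ->]]; apply/mapP; exists (X, ~~ s).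
Qed.

Lemma first_sign_relabel f c X : {in unsign c &, injective f} -> X \in unsign c ->
  first_sign (relabel f c) (f X) = first_sign c X.
Proof.
move=> If Xc; have: {in unsign c, forall Y, (f Y == f X) = (Y == X)}.
  by move=> Y Yc; apply/eqP/eqP => [/If|->//]; apply.
elim: c {If Xc} => //= -[Y s] c IH H /=; rewrite H ?mem_head // IH // => Z Zc.
by apply: H; rewrite in_cons Zc orbT.
Qed.

(** Rotations make it enough to state each homotopy move at the start of the code,
    and the sign [s] covers both types in H1 and H3 and both distributions of the
    opposite types in H2. *)
Inductive code_move : code -> code -> Prop :=
| CRelabel f c of {in unsign c &, injective f} : code_move c (relabel f c)
| CRot k c : code_move c (rot k c)
| CH1 A s y : code_move [:: (A, s), (A, ~~ s) & y] y
| CH2 A B s y z :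
    code_move [:: (A, s), (B, ~~ s) & y ++ [:: (B, s), (A, ~~ s) & z]] (y ++ z)
| CH3 A B C s y z t :
    code_move [:: (A, s), (B, s) & y ++ [:: (A, ~~ s), (C, s) & z ++
                 [:: (B, ~~ s), (C, ~~ s) & t]]]
              [:: (B, s), (A, s) & y ++ [:: (C, s), (A, ~~ s) & z ++
                 [:: (C, ~~ s), (B, ~~ s) & t]]].

Lemma wf_rot k c : wf (rot k c) = wf c.
Proof. by apply/idP/idP; apply: wf_perm; rewrite ?(perm_sym c) perm_rot. Qed.

Lemma code_move_wf c d : code_move c d -> wf c -> wf d.
Proof.
case=> [f {}c|k {}c|A s y|A B s y z|A B C s y z t].
- exact: wf_relabel.
- by rewrite wf_rot.
- by rewrite wf_cons2 => /andP[].
- move=> W; have: wf [:: (A, s), (A, ~~ s), (B, s), (B, ~~ s) & y ++ z].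
    by apply: wf_perm W; by_perm.
  by case: (s); rewrite 2?wf_cons2 => /and3P[].
- by apply: wf_perm; by_perm.
Qed.

Lemma code_of_sub m n d : wf d -> unsign d = nw_word n ->
  {subset nw_word n <= nw_word m} -> {in nw_word n, nw_type n =1 nw_type m} ->
  {in nw_word n, first_sign d =1 first_sign (code_of m)} -> code_of n = d.
Proof.
move=> Wd Ed Smn Et Es; apply: code_of_eq => // X Xn.
by rewrite Et // nw_type_code_of ?Smn // Es.
Qed.

Section Invariance.
Variables (T : Type) (I : code -> T).
Hypothesis II : forall c d, wf c -> code_move c d -> I c = I d.

Lemma invariant_rot c d : wf (c ++ d) -> I (c ++ d) = I (d ++ c).
Proof. by move=> W; rewrite (II W (CRot (size c) _)) rot_size_cat. Qed.

(** A move of nanowords is a rotation of the code, a [code_move] and a rotation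
    back; a shift move is a rotation followed by a relabelling. *)
Lemma move_invariant m n : move m n -> I (code_of m) = I (code_of n).
Proof.
have Wm := wf_code_of m; have Gn := nw_gauss n; have Wn := wf_code_of n.
case=> [f If En Et|A B x y Em En EB Et|A x y Em En Et|A B x y z Em En EB Et|
        A B C x y z t Em En EAB EBC Et].
- rewrite (II Wm (CRelabel (f := f) _)) ?unsign_code_of //; congr I; apply/esym/code_of_eq.
  + by apply: wf_relabel; rewrite ?unsign_code_of.
  + by rewrite unsign_relabel unsign_code_of En.
  + move=> Y; rewrite En => /mapP[X Xm ->]; rewrite Et // first_sign_relabel ?unsign_code_of //.
    exact: nw_type_code_of.
- have [s [c [Ec /unsign_cat[cx [cy' [Ecx Ex /unsign_cons[s' [cy [Ecy Ey]]]]]]]]] : 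
    exists s d, code_of m = (A, s) :: d /\ unsign d = x ++ A :: y.
    by apply: unsign_cons; rewrite unsign_code_of Em.
  subst cy' c.
  have Es' : s' = ~~ s.
    have := wf_uniq Wm; rewrite Ec -[_ :: _]/([::] ++ _) => /uniq_sign; apply.
    by rewrite mem_cat mem_head orbT.
  subst s'; rewrite Ec in Wm.
  have W' : wf [:: (A, s), (A, ~~ s) & cx ++ cy] by apply: wf_perm Wm; by_perm.
  have nA : A \notin x ++ y.
    by move: W'; rewrite wf_cons2 /unsign map_cat -!/(unsign _) Ex Ey => /andP[].
  have nB : B \notin x ++ y.
    have : B \in nw_word n by rewrite En !(in_cons, mem_cat) eqxx !orbT.
    move/(allP Gn); rewrite En /= !count_cat /= !count_cat /= eqxx => /eqP C.
    by rewrite -has_pred1 has_count count_cat; move: (count_mem B x) (count_mem B y) C => a b; lia.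
  (* The letter that is carried around may change its name from A to B. *)
  pose f X := if X == A then B else X.
  have If : {in unsign ((A, s) :: cx ++ (A, ~~ s) :: cy) &, injective f}.
    have H X : X \in unsign ((A, s) :: cx ++ (A, ~~ s) :: cy) -> X != A -> X \in x ++ y.
      rewrite /= /unsign map_cat /= -!/(unsign _) Ex Ey.
      by rewrite !(in_cons, mem_cat) => + /negPf nX; rewrite nX.
    move=> X Y /H HX /H HY; rewrite /f; case: eqP HX => [-> _|/eqP nX /(_ isT) HX];
      case: eqP HY => [-> _|/eqP nY /(_ isT) HY] // E; first by rewrite E HY in nB.
    by rewrite -E HX in nB.
  have fid c : unsign c \in [:: x; y] -> relabel f c = c.
    move=> cxy; rewrite /relabel -[RHS]map_id; apply/eq_in_map => -[X t] /unsign_mem Xc.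
    rewrite /f /=; case: eqP => // E; case/negP: nA; rewrite -E mem_cat.
    by move: cxy; rewrite !inE => /orP[] /eqP <-; rewrite Xc ?orbT.
  have Er : rot 1 (relabel f ((A, s) :: cx ++ (A, ~~ s) :: cy)) =
      cx ++ (B, ~~ s) :: cy ++ [:: (B, s)].
    rewrite /relabel /= map_cat /= -!/(relabel f _) !fid ?Ex ?Ey ?inE ?eqxx ?orbT //.
    by rewrite /f eqxx rot1_cons -cats1 -catA.
  have Wr := wf_relabel If Wm; rewrite -(wf_rot 1) Er in Wr.
  rewrite Ec (II Wm (CRelabel If)) (II (wf_relabel If Wm) (CRot 1 _)) Er; congr I.
  apply/esym/code_of_eq => // [|X].
    by rewrite /unsign map_cat /= map_cat -!/(unsign _) Ex Ey En.
  rewrite En !(mem_cat, inE) => XE.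
  have [->|nXB] := eqVneq X B.
    rewrite EB (nw_type_code_of (X := A)) ?Em ?mem_head // Ec /= eqxx -of_signN.
    by rewrite first_sign_cat Ex; move: nB; rewrite mem_cat => /norP[/negPf-> _] /=; rewrite eqxx.
  have Xxy : X \in x ++ y by move: XE; rewrite mem_cat (negPf nXB) /= orbF.
  have nXA : (A == X) = false by apply/eqP => E; rewrite E Xxy in nA.
  rewrite Et // nw_type_code_of ?Em ?Ec; last first.
    by move: Xxy; rewrite !(mem_cat, inE) => /orP[]->; rewrite ?orbT.
  congr of_sign; rewrite /= nXA !first_sign_cat /= nXA (eq_sym B) (negPf nXB).
  rewrite first_sign_cat Ex Ey; move: Xxy; rewrite mem_cat; case: (X \in x) => //= ->.
  by [].
- have [cx [cr [Ec Ex]]] : exists cx cr, [/\ code_of m = cx ++ cr, unsign cx = x &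
      unsign cr = [:: A; A] ++ y] by apply: unsign_cat; rewrite unsign_code_of.
  case/unsign_cons=> s [c' [Ec' /unsign_cons[s' [cy [Ecy Ey]]]]]; subst c' cr.
  have Es' : s' = ~~ s.
    by have := wf_uniq Wm; rewrite Ec => /uniq_sign; apply; rewrite mem_head.
  subst s'; have W' : wf [:: (A, s), (A, ~~ s) & cy ++ cx].
    by apply: wf_perm Wm; rewrite Ec; by_perm.
  rewrite Ec invariant_rot -?Ec // (II W' (CH1 _ _ _)).
  move: W'; rewrite wf_cons2 => /andP[nA W'].
  rewrite invariant_rot //; congr I; apply/esym/(code_of_sub (m := m)).
  + by rewrite -(wf_rot (size cx)) rot_size_cat.
  + by rewrite /unsign map_cat -!/(unsign _) Ex Ey.
  + by move=> X; rewrite En Em !(mem_cat, inE) => /orP[]->; rewrite ?orbT.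
  + by rewrite En.
  + move=> X; rewrite En -Ex -Ey -/(unsign _) Ec !first_sign_cat /= => Xxy.
    case: (eqVneq A X) => // E; case/negP: nA.
    by rewrite E /unsign map_cat -!/(unsign _) mem_cat orbC -mem_cat.
- have [cx [cr [Ec Ex]]] : exists cx cr, [/\ code_of m = cx ++ cr, unsign cx = x &
      unsign cr = [:: A, B & y ++ [:: B, A & z]]] by apply: unsign_cat; rewrite unsign_code_of.
  case/unsign_cons=> s [c' [Ec' /unsign_cons[t [c'' [Ecy]]]]]; subst c' cr.
  case/unsign_cat=> cy [c' [Ecy Ey /unsign_cons[t' [d [Ed /unsign_cons[s' [cz [Ecz Ez]]]]]]]].
  subst d c' c''.
  have U := wf_uniq Wm; rewrite Ec in U.
  have ? : s' = ~~ s by apply: (uniq_sign U); rewrite !(mem_cat, inE) eqxx !orbT.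
  have ? : t' = ~~ t.
    by rewrite -cat_rcons in U; apply: (uniq_sign U); rewrite !(mem_cat, inE) eqxx !orbT.
  subst s' t'.
  have EA : nw_type m A = of_sign s.
    rewrite nw_type_code_of ?Em ?mem_cat ?inE ?eqxx ?orbT // Ec -cat_rcons.
    rewrite (@first_sign_before _ _ _ s) ?cat_rcons // ?mem_rcons ?mem_head //.
    by rewrite !(mem_cat, inE) eqxx !orbT.
  have {}EB : of_sign t = opposite (of_sign s).
    rewrite -EA -EB nw_type_code_of ?Em ?mem_cat ?inE ?eqxx ?orbT // Ec -cat_rcons -cat_rcons.
    rewrite (@first_sign_before _ _ _ t) ?cat_rcons // ?mem_rcons ?mem_head //.
    by rewrite !(mem_cat, inE) eqxx !orbT.
  have {EB} ? : t = ~~ s by move: EB; rewrite -of_signN => /(can_inj of_signK).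
  subst t; rewrite negbK in Ec U.
  have W' : wf [:: (A, s), (B, ~~ s) & cy ++ [:: (B, s), (A, ~~ s) & cz ++ cx]].
    by apply: wf_perm Wm; rewrite Ec; by_perm.
  have W1 : wf ((cy ++ cz) ++ cx) by rewrite -catA; apply: code_move_wf W'; apply: CH2.
  have W2 : wf (cx ++ cy ++ cz) by rewrite -(wf_rot (size cx)) rot_size_cat.
  rewrite Ec invariant_rot -?Ec //= -catA (II W' (CH2 _ _ _ _ _)) catA invariant_rot //.
  congr I; apply/esym/(code_of_sub (m := m)) => //.
  + by rewrite /unsign !map_cat -!/(unsign _) Ex Ey Ez.
  + by move=> X; rewrite En Em !(mem_cat, inE) => /or3P[]->; rewrite ?orbT.
  + by rewrite En.
  + move=> X; rewrite En -Ex -Ey -Ez Ec !first_sign_cat /= first_sign_cat /= => Xxy.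
    have H Y : Y \in [:: A; B] -> Y != X.
      move=> YAB; apply/eqP => E; subst Y; move: Xxy.
      have : wf [:: (A, s), (A, ~~ s), (B, s), (B, ~~ s) & cx ++ cy ++ cz].
        by apply: wf_perm Wm; rewrite Ec; by_perm.
      rewrite wf_cons4 /unsign !map_cat => /and4P[_ nA nB _].
      by move: YAB; rewrite !inE => /orP[] /eqP->; apply/negP.
    by rewrite !(negPf (H _ _)) ?inE ?eqxx ?orbT.
- have [cx [cr [Ec Ex]]] : exists cx cr, [/\ code_of m = cx ++ cr, unsign cx = x &
      unsign cr = [:: A, B & y ++ [:: A, C & z ++ [:: B, C & t]]]].
    by apply: unsign_cat; rewrite unsign_code_of.
  case/unsign_cons=> s [c' [Ec' /unsign_cons[s1 [c'' [Ecy]]]]]; subst c' cr.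
  case/unsign_cat=> cy [c' [Ecy Ey /unsign_cons[s2 [d [Ed /unsign_cons[s3 [d' [Ed']]]]]]]].
  subst d c' c''.
  case/unsign_cat=> cz [c' [Ecz Ez /unsign_cons[s4 [d [Ed /unsign_cons[s5 [ct [Ect Et']]]]]]]].
  subst d c' d'.
  have U := wf_uniq Wm; rewrite Ec in U.
  have ? : s2 = ~~ s by apply: (uniq_sign U); rewrite !(mem_cat, inE) eqxx !orbT.
  have ? : s4 = ~~ s1.
    by rewrite -cat_rcons in U; apply: (uniq_sign U); rewrite !(mem_cat, inE) eqxx !orbT.
  have EqC : cx ++ [:: (A, s), (B, s1) & cy ++ [:: (A, s2), (C, s3) & cz ++
       [:: (B, s4), (C, s5) & ct]]] = (cx ++ [:: (A, s), (B, s1) & cy ++ [:: (A, s2)]]) ++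
       (C, s3) :: cz ++ [:: (B, s4), (C, s5) & ct] by rewrite -catA /= -catA.
  have ? : s5 = ~~ s3.
    by rewrite EqC in U; apply: (uniq_sign U); rewrite !(mem_cat, inE) eqxx !orbT.
  subst s2 s4 s5.
  have EA : nw_type m A = of_sign s.
    rewrite nw_type_code_of ?Em ?mem_cat ?inE ?eqxx ?orbT // Ec -cat_rcons.
    rewrite (@first_sign_before _ _ _ s) ?cat_rcons // ?mem_rcons ?mem_head //.
    by rewrite !(mem_cat, inE) eqxx !orbT.
  have EB : nw_type m B = of_sign s1.
    rewrite nw_type_code_of ?Em ?mem_cat ?inE ?eqxx ?orbT // Ec -cat_rcons -cat_rcons.
    rewrite (@first_sign_before _ _ _ s1) ?cat_rcons // ?mem_rcons ?mem_head //.
    by rewrite !(mem_cat, inE) eqxx !orbT.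
  have EC : nw_type m C = of_sign s3.
    rewrite nw_type_code_of; last by rewrite Em !(mem_cat, inE) eqxx !orbT.
    rewrite Ec EqC -cat_rcons; rewrite EqC -cat_rcons in U.
    by rewrite (@first_sign_before _ _ _ s3) // ?mem_rcons ?mem_head // !(mem_cat, inE) eqxx !orbT.
  have ? : s1 = s by apply: (can_inj of_signK); rewrite -EB -EAB EA.
  have ? : s3 = s by apply: (can_inj of_signK); rewrite -EC -EBC EB; congr of_sign.
  subst s1 s3.
  have W1 : wf ([:: (A, s), (B, s) & cy ++ [:: (A, ~~ s), (C, s) & cz ++
       [:: (B, ~~ s), (C, ~~ s) & ct ++ cx]]]).
    by apply: wf_perm Wm; rewrite Ec; by_perm.
  have [nAB nAC nBC] : [/\ A != B, A != C & B != C].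
    by split; apply/eqP => E; move: (wf_uniq W1);
      rewrite E /= !(mem_cat, inE) eqxx ?orbT ?andbF.
  have W2 := code_move_wf (CH3 _ _ _ _ _ _ _) W1.
  set d := [:: (B, s), (A, s) & _] in W2.
  pose e := cx ++ [:: (B, s), (A, s) & cy ++ [:: (C, s), (A, ~~ s) & cz ++
       [:: (C, ~~ s), (B, ~~ s) & ct]]].
  have Pnm : perm_eq (nw_word n) (nw_word m) by rewrite En Em; by_perm.
  have Er : rot (size cx) e = d by rewrite rot_size_cat /= -catA /= -catA.
  have We : wf e by rewrite -(wf_rot (size cx)) Er.
  rewrite Ec invariant_rot -?Ec //= -catA /= -catA /= (II W1 (CH3 _ _ _ _ _ _ _)) -/d -Er.
  rewrite -(II We (CRot _ _)); congr I; apply/esym/(code_of_sub (m := m)) => //.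
  + by rewrite En -Ex -Ey -Ez -Et' /e /unsign !map_cat /= !map_cat /= !map_cat.
  + by move=> X; rewrite (perm_mem Pnm).
  + by move=> X; rewrite (perm_mem Pnm) => /Et.
  + move=> X _; rewrite Ec first_sign_filter [RHS]first_sign_filter /e.
    rewrite !filter_cat /= !filter_cat /= !filter_cat /=.
    case: (eqVneq A X) => [E|_]; first by rewrite -E !(eq_sym _ A) (negPf nAB) (negPf nAC).
    by case: (eqVneq B X) => // E; rewrite -E !(eq_sym _ B) (negPf nBC).
Qed.

Lemma homotopic_invariant m n : homotopic m n -> I (code_of m) = I (code_of n).
Proof.
elim=> {m n} [m n|//|m n _ -> //|m p n _ -> _ -> //].
exact: move_invariant.
Qed.

End Invariance.

(** A rotation by one step is the shift move with [B] equal to [A]. *)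
Lemma homotopic_nano_rot1 c : wf c -> homotopic (nano c) (nano (rot 1 c)).
Proof.
move=> W; case: c W => [|[A s] c] W; first exact: rst_refl.
have Ac : (A, ~~ s) \in c.
  have: (A, ~~ s) \in (A, s) :: c by rewrite wf_mem //= mem_head.
  by rewrite in_cons xpair_eqE eqxx /=; case: (s).
case/splitPr: Ac W => [x y] W.
have [nA Wxy] : A \notin unsign (x ++ y) /\ wf (x ++ y).
  by apply/andP; rewrite -(wf_cons2 _ s); apply: wf_perm W; by_perm.
have W' : wf (rot 1 ((A, s) :: x ++ (A, ~~ s) :: y)) by rewrite wf_rot.
apply: rst_step; apply: (@Shift _ _ A A (unsign x) (unsign y)).
- by rewrite nw_word_nano //= /unsign map_cat.
- by rewrite nw_word_nano // rot1_cons -cats1 -catA /unsign map_cat /= map_cat.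
- rewrite !nw_type_nano // rot1_cons -cats1 -catA first_sign_cat /= !eqxx.
  by move: nA; rewrite /unsign map_cat mem_cat => /norP[/negPf-> _]; apply: of_signN.
- move=> X; rewrite /unsign -map_cat => Xxy; rewrite !nw_type_nano //.
  have nAX : (A == X) = false by apply: contraNF nA => /eqP ->.
  congr of_sign; rewrite rot1_cons -cats1 first_sign_filter [RHS]first_sign_filter.
  by rewrite !(filter_cat, cats0) /= !filter_cat /= nAX cats0.
Qed.

Lemma homotopic_nano c d : wf c -> code_move c d -> homotopic (nano c) (nano d).
Proof.
move=> W cd; have W' := code_move_wf cd W.
move: W W'; case: cd => [f {}c If|k {}c|A s y|A B s y z|A B C s y z t] W W'.
- apply: rst_step; apply: (@Isomorphism _ _ f); rewrite ?nw_word_nano ?unsign_relabel // => X Xc.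
  by rewrite !nw_type_nano // first_sign_relabel.
- elim: k => [|k IH] in W' *; first by rewrite rot0; apply: rst_refl.
  have Wk : wf (rot k c) by rewrite wf_rot.
  apply: rst_trans (IH Wk) _ => {IH}; case: (ltnP k (size c)) => [kc|ck].
    by rewrite rotS //; apply: homotopic_nano_rot1.
  by rewrite !rot_oversize // ?(leq_trans ck) //; apply: rst_refl.
- apply: rst_step; apply: (@H1 _ _ A [::] (unsign y)); rewrite ?nw_word_nano //.
  move=> X Xy; rewrite !nw_type_nano //=; case: (eqVneq A X) => // E.
  by move: W; rewrite wf_cons2 E Xy.
- have /and4P[nAB nA nB _] : [&& A != B, A \notin unsign (y ++ z), B \notin unsign (y ++ z) & wf (y ++ z)].
    by rewrite -(wf_cons4 _ s _ s); apply: wf_perm W; by_perm.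
  apply: rst_step; apply: (@H2 _ _ A B [::] (unsign y) (unsign z)).
  + by rewrite nw_word_nano //= /unsign map_cat.
  + by rewrite nw_word_nano //= /unsign map_cat.
  + by rewrite !nw_type_nano //= !eqxx (negPf nAB) of_signN.
  + move=> X; rewrite /= -map_cat => Xyz; rewrite !nw_type_nano //; congr of_sign.
    have nX Y : Y \notin unsign (y ++ z) -> (Y == X) = false.
      by move=> nY; apply: contraNF nY => /eqP ->.
    by rewrite first_sign_filter [RHS]first_sign_filter /= !filter_cat /= !nX.
- have [nAB nAC nBC] : [/\ A != B, A != C & B != C].
    by split; apply/eqP => E; move: (wf_uniq W);
      rewrite E /= !(mem_cat, inE) eqxx ?orbT ?andbF.
  have tA : first_sign ([:: (A, s), (B, s) & y ++ [:: (A, ~~ s), (C, s) & z ++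
                 [:: (B, ~~ s), (C, ~~ s) & t]]]) A = s by rewrite /= eqxx.
  have tB : first_sign ([:: (A, s), (B, s) & y ++ [:: (A, ~~ s), (C, s) & z ++
                 [:: (B, ~~ s), (C, ~~ s) & t]]]) B = s by rewrite /= (negPf nAB) eqxx.
  have tC : first_sign ([:: (A, s), (B, s) & y ++ [:: (A, ~~ s), (C, s) & z ++
                 [:: (B, ~~ s), (C, ~~ s) & t]]]) C = s.
    have Eq : [:: (A, s), (B, s) & y ++ [:: (A, ~~ s), (C, s) & z ++
                 [:: (B, ~~ s), (C, ~~ s) & t]]] =
             ([:: (A, s), (B, s) & y ++ [:: (A, ~~ s); (C, s)]]) ++ z ++
                 [:: (B, ~~ s), (C, ~~ s) & t] by rewrite /= -catA.
    rewrite Eq; apply: first_sign_before; rewrite -?Eq ?wf_uniq //.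
      by rewrite !(mem_cat, inE) eqxx !orbT.
    by rewrite !(mem_cat, inE) eqxx !orbT.
  apply: rst_step; apply: (@H3 _ _ A B C [::] (unsign y) (unsign z) (unsign t)).
  + by rewrite nw_word_nano //= /unsign !map_cat /= map_cat.
  + by rewrite nw_word_nano //= /unsign !map_cat /= map_cat.
  + by rewrite !nw_type_nano // tA tB.
  + by rewrite !nw_type_nano // tC tB.
  + move=> X _; rewrite !nw_type_nano //; congr of_sign.
    rewrite first_sign_filter [RHS]first_sign_filter /= !filter_cat /= !filter_cat /=.
    case: (eqVneq A X) => [E|_]; first by rewrite -E !(eq_sym _ A) (negPf nAB) (negPf nAC).
    by case: (eqVneq B X) => // E; rewrite -E !(eq_sym _ B) (negPf nBC).
Qed.

(** * Index and intersection data *)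

Section Sums.
Local Open Scope Z_scope.

Definition sumz (L : seq letter) (F : letter -> Z) : Z := foldr (fun X z => F X + z) 0 L.

Lemma sumz_cons X L F : sumz (X :: L) F = F X + sumz L F.
Proof. by []. Qed.

Lemma eq_sumz L F G : {in L, F =1 G} -> sumz L F = sumz L G.
Proof.
elim: L => //= X L IH H; rewrite H ?mem_head // IH // => Y YL.
by apply: H; rewrite in_cons YL orbT.
Qed.

Lemma sumz_cat L L' F : sumz (L ++ L') F = sumz L F + sumz L' F.
Proof. by elim: L => //= X L ->; lia. Qed.

Lemma sumz_perm L L' F : perm_eq L L' -> sumz L F = sumz L' F.
Proof.
elim: L L' => [|X L IH] L' P; first by case: L' P => // Y L' /perm_size.
have: X \in L' by rewrite -(perm_mem P) mem_head.
move=> XL'; case/splitPr: XL' P => L1 L2; rewrite perm_sym perm_catC /= perm_cons perm_catC => P.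
rewrite (IH (L1 ++ L2)) 1?perm_sym // !sumz_cat /=; lia.
Qed.

Lemma sumz_map K f F : sumz (map f K) F = sumz K (F \o f).
Proof. by elim: K => //= X K ->. Qed.

Lemma sumzD L F G : sumz L (fun X => F X + G X) = sumz L F + sumz L G.
Proof. by elim: L => //= X L ->; lia. Qed.

Lemma sumzN L F : sumz L (fun X => - F X) = - sumz L F.
Proof. by elim: L => //= X L ->; lia. Qed.

Lemma sumz0 L : sumz L (fun=> 0) = 0.
Proof. by elim: L => //= X L ->. Qed.

(** The cyclic orientation of three distinct positions: two of the three cyclic
    comparisons hold if [i], [j], [k] are in cyclic order, one otherwise, so that
    the value is [1] or [-1]. *)
Definition cyc (i j k : nat) : Z :=
  2 * Z.of_nat ((i < j) + (j < k) + (k < i)) - 3.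

End Sums.

(** In this section [d A (X, s)] tells on which side of the arrow [A] the occurrence
    [(X, s)] lies; it is [1] on the arc from the positive to the negative occurrence
    of [A], [-1] on the other arc and [0] if [X] is [A]. *)
Section Weights.
Local Open Scope Z_scope.
Variables (L : seq letter) (d : letter -> letter * bool -> Z).

(** Twice the signed number of arrows that cross [A], which is Turaev's index. *)
Definition idx (A : letter) : Z := sumz L (fun X => d A (X, true) - d A (X, false)).

(** The homological intersection number of the cycles A - A' and B - B', where A is
    the loop at the crossing [A] and A' the complementary loop.  Unlike the
    intersection number of A and B, it changes sign when A and A' are exchanged. *)
Definition inter (A B : letter) : Z :=
  sumz L (fun X => d A (X, true) * d B (X, false) - d A (X, false) * d B (X, true)).

Definition side (A B : letter) : Z := d A (B, true) + d A (B, false).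

(** Replacing [A] by its complement fixes this number, as [inter A B] occurs squared,
    and changes the sign of the next one; the powers of [idx B] are chosen so that
    two complementary letters [B] cancel in both sums. *)
Definition wgt2 (A : letter) : Z := sumz L (fun B => idx B * (inter A B * inter A B)).

Definition wgt1 (A : letter) : Z := sumz L (fun B => (idx B * idx B) * inter A B).

Definition refined (P : Z -> Z -> Z -> Z) : Z :=
  sumz L (fun A => P (idx A) (wgt2 A) (wgt1 A)).

(** An odd symmetric polynomial that vanishes if [p = 0] or [p + q = 0] and
    whose sum over the three pairs from [p], [q], [- p - q] is zero. *)
Definition cocycle (p q : Z) : Z := p * q * (p + q) * (p * p + 4 * p * q + q * q).

(** Only unlinked arrows contribute, since [side A B] is [0] for linked ones.  For
    unlinked ones the signs [side A B] and [side B A] orient both loops so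
    that they are disjoint, up to a common factor. *)
Definition pair_wgt (A B : letter) : Z :=
  side A B * side B A * cocycle (side A B * idx A) (side B A * idx B).

Definition pairing : Z := sumz L (fun A => sumz L (pair_wgt A)).

Lemma interC A B : inter A B = - inter B A.
Proof. by rewrite -sumzN; apply: eq_sumz => X _; lia. Qed.

Lemma interAA A : inter A A = 0.
Proof. by have := interC A A; lia. Qed.

Lemma pair_wgtC A B : pair_wgt A B = pair_wgt B A.
Proof. by rewrite /pair_wgt /cocycle; ring. Qed.

End Weights.

Arguments sumz : simpl never.
Arguments idx : simpl never.
Arguments inter : simpl never.
Arguments wgt1 : simpl never.
Arguments wgt2 : simpl never.

Section WeightsPerm.
Local Open Scope Z_scope.
Variables (L L' : seq letter) (d : letter -> letter * bool -> Z).
Hypothesis P : perm_eq L L'.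

Lemma idx_perm A : idx L d A = idx L' d A.
Proof. exact: sumz_perm. Qed.

Lemma inter_perm A B : inter L d A B = inter L' d A B.
Proof. exact: sumz_perm. Qed.

Lemma refined_perm W : refined L d W = refined L' d W.
Proof.
rewrite /refined (sumz_perm _ P); apply: eq_sumz => A _; rewrite idx_perm; congr (W _ _ _).
  by rewrite /wgt2 (sumz_perm _ P); apply: eq_sumz => B _; rewrite idx_perm inter_perm.
by rewrite /wgt1 (sumz_perm _ P); apply: eq_sumz => B _; rewrite idx_perm inter_perm.
Qed.

Lemma pairing_perm : pairing L d = pairing L' d.
Proof.
rewrite /pairing (sumz_perm _ P); apply: eq_sumz => A _; rewrite (sumz_perm _ P).
by apply: eq_sumz => B _; rewrite /pair_wgt !idx_perm.
Qed.
End WeightsPerm.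

(** The refined sums only depend on the indices and the intersection numbers; the
    renaming [f] is the identity in the application to H3. *)
Lemma refined_eq L d L' d' W f : L' = map f L ->
  {in L, forall A, idx L' d' (f A) = idx L d A} ->
  {in L &, forall A B, inter L' d' (f A) (f B) = inter L d A B} ->
  refined L' d' W = refined L d W.
Proof.
move=> EL EI EN; rewrite /refined {1}EL sumz_map; apply: eq_sumz => A AL /=.
rewrite EI //; congr (W _ _ _).
  by rewrite /wgt2 {1}EL sumz_map; apply: eq_sumz => B BL /=; rewrite EI // EN.
by rewrite /wgt1 {1}EL sumz_map; apply: eq_sumz => B BL /=; rewrite EI // EN.
Qed.

Section OddWeight.
Local Open Scope Z_scope.
(** The condition under which a weight kills isolated letters and cancels on pairs of
    complementary letters. *)
Definition odd_weight (W : Z -> Z -> Z -> Z) : Prop :=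
  (forall e h, W 0 e h = 0) /\ (forall n e h, W (- n) e (- h) = - W n e h).
End OddWeight.

(** The effect of H1: the new letter [A] has index zero, and both its occurrences lie
    on the same side of any other letter. *)
Section Isolated.
Local Open Scope Z_scope.
Variables (L : seq letter) (A : letter) (d d0 : letter -> letter * bool -> Z).
Hypothesis E0 : {in L &, forall X Y s, d X (Y, s) = d0 X (Y, s)}.
Hypothesis EA : {in L, forall X, d X (A, true) = d X (A, false)}.
Hypothesis AE : {in L, forall X, d A (X, true) = d A (X, false)}.
Hypothesis AA : forall s, d A (A, s) = 0.

Lemma isolated_idx X : X \in L -> idx (A :: L) d X = idx L d0 X.
Proof.
move=> XL; rewrite /idx !sumz_cons EA // Z.sub_diag.
by apply: eq_sumz => Y YL; rewrite !E0.
Qed.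

Lemma isolated_idx0 : idx (A :: L) d A = 0.
Proof.
rewrite /idx !sumz_cons !AA -[RHS](sumz0 L); apply: eq_sumz => Y YL.
by rewrite AE //; lia.
Qed.

Lemma isolated_inter X Y : X \in L -> Y \in L -> inter (A :: L) d X Y = inter L d0 X Y.
Proof.
move=> XL YL; rewrite /inter !sumz_cons !EA // Z.sub_diag.
by apply: eq_sumz => Z ZL; rewrite !E0.
Qed.

Lemma isolated_refined W : odd_weight W -> refined (A :: L) d W = refined L d0 W.
Proof.
case=> W0 _; rewrite /refined sumz_cons isolated_idx0 W0; apply: eq_sumz => X XL.
rewrite isolated_idx //; congr (W _ _ _).
  rewrite /wgt2 sumz_cons isolated_idx0; apply: eq_sumz => Y YL.
  by rewrite isolated_idx // isolated_inter.
rewrite /wgt1 sumz_cons isolated_idx0; apply: eq_sumz => Y YL.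
by rewrite isolated_idx // isolated_inter.
Qed.

Lemma isolated_pairing : pairing (A :: L) d = pairing L d0.
Proof.
have P0 X : pair_wgt (A :: L) d A X = 0.
  by rewrite /pair_wgt /cocycle isolated_idx0; ring.
rewrite /pairing sumz_cons (@eq_sumz (A :: L) _ (fun=> 0)) => [|X _]; last exact: P0.
rewrite sumz0; apply: eq_sumz => X XL; rewrite sumz_cons pair_wgtC P0.
apply: eq_sumz => Y YL.
by rewrite /pair_wgt /side !E0 // !isolated_idx.
Qed.
End Isolated.

(** The effect of H2: the new letters [A] and [B] carry complementary loops, with
    their occurrences exchanged as seen from the other letters. *)
Section Complementary.
Local Open Scope Z_scope.
Variables (L : seq letter) (A B : letter) (u : Z) (s : bool) (d d0 : letter -> letter * bool -> Z).
Hypothesis E0 : {in L &, forall X Y s, d X (Y, s) = d0 X (Y, s)}.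
Hypothesis EB : {in L, forall X s, d X (B, s) = d X (A, ~~ s)}.
Hypothesis BE : {in L, forall X s, d B (X, s) = - d A (X, s)}.
Hypotheses (AA : forall s, d A (A, s) = 0) (BB : forall s, d B (B, s) = 0).
Hypotheses (AB : forall s, d A (B, s) = u) (BA : forall s, d B (A, s) = u).
Let K := A :: B :: L.

Lemma complementary_idx X : X \in L -> idx K d X = idx L d0 X.
Proof.
move=> XL; rewrite /idx !sumz_cons !EB //=.
rewrite (@eq_sumz _ _ (fun Y : letter => d0 X (Y, true) - d0 X (Y, false))); first by lia.
by move=> Y YL; rewrite !E0.
Qed.

Lemma complementary_idxN : idx K d B = - idx K d A.
Proof.
rewrite /idx !sumz_cons !AA !BB !AB !BA Z.sub_diag /= -sumzN; apply: eq_sumz => X XL.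
by rewrite !BE //; lia.
Qed.

Lemma complementary_inter X Y : X \in L -> Y \in L -> inter K d X Y = inter L d0 X Y.
Proof.
move=> XL YL; rewrite /inter !sumz_cons !EB //=.
rewrite (@eq_sumz _ _ (fun Z : letter => d0 X (Z, true) * d0 Y (Z, false) -
   d0 X (Z, false) * d0 Y (Z, true))); first by lia.
by move=> Z ZL; rewrite !E0.
Qed.

Lemma complementary_interN X : X \in L -> inter K d B X = - inter K d A X.
Proof.
move=> XL; rewrite /inter !sumz_cons !AA !BB !AB !BA !EB //=.
rewrite (@eq_sumz L (fun Z : letter => d B (Z, true) * d X (Z, false) - _)
  (fun Z : letter => - (d A (Z, true) * d X (Z, false) - d A (Z, false) * d X (Z, true)))).
  by rewrite sumzN; ring.
by move=> Z ZL; rewrite !BE //; ring.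
Qed.

Lemma complementary_inter0 : inter K d A B = 0.
Proof.
rewrite /inter !sumz_cons !AA !BB -[RHS](sumz0 L); rewrite !Z.mul_0_r !Z.mul_0_l /=.
by apply: eq_sumz => Z ZL; rewrite !BE //; ring.
Qed.

Lemma complementary_refined W : odd_weight W -> refined K d W = refined L d0 W.
Proof.
case=> W0 WN.
have N1 : wgt1 K d B = - wgt1 K d A.
  rewrite /wgt1 !sumz_cons complementary_idxN !interAA [inter K d B A]interC complementary_inter0.
  rewrite -/K (@eq_sumz L (fun X : letter => _ * inter K d B X)
    (fun X : letter => - ((idx K d X * idx K d X) * inter K d A X))).
    by rewrite sumzN; ring.
  by move=> X XL; rewrite complementary_interN //; ring.
have N2 : wgt2 K d B = wgt2 K d A.
  rewrite /wgt2 !sumz_cons complementary_idxN !interAA [inter K d B A]interC complementary_inter0.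
  rewrite -/K (@eq_sumz L (fun X : letter => idx K d X * (inter K d B X * _))
    (fun X : letter => idx K d X * (inter K d A X * inter K d A X))).
    by ring.
  by move=> X XL; rewrite complementary_interN //; ring.
rewrite /refined !sumz_cons -/K complementary_idxN N1 N2 WN.
rewrite (@eq_sumz L _ (fun X : letter => W (idx L d0 X) (wgt2 L d0 X) (wgt1 L d0 X))); first by lia.
move=> X XL; rewrite complementary_idx //; congr (W _ _ _).
  rewrite /wgt2 !sumz_cons -/K complementary_idxN ![inter K d X _]interC complementary_interN //.
  rewrite (@eq_sumz L _ (fun Y : letter => idx L d0 Y * (inter L d0 X Y * inter L d0 X Y))); first by ring.
  by move=> Y YL; rewrite complementary_idx // complementary_inter.
rewrite /wgt1 !sumz_cons -/K complementary_idxN ![inter K d X _]interC complementary_interN //.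
rewrite (@eq_sumz L _ (fun Y : letter => idx L d0 Y * idx L d0 Y * inter L d0 X Y)); first by ring.
by move=> Y YL; rewrite complementary_idx // complementary_inter.
Qed.

Lemma complementary_pairing : pairing K d = pairing L d0.
Proof.
have PN X : X \in L -> pair_wgt K d B X = - pair_wgt K d A X.
  move=> XL; rewrite /pair_wgt /side !BE // !EB //= complementary_idxN /cocycle; ring.
have PAA : pair_wgt K d A A = 0 by rewrite /pair_wgt /side !AA; ring.
have PBB : pair_wgt K d B B = 0 by rewrite /pair_wgt /side !BB; ring.
have PAB : pair_wgt K d A B = 0.
  by rewrite /pair_wgt /side /cocycle !AB !BA complementary_idxN; ring.
rewrite /pairing !sumz_cons -/K PAA PBB [pair_wgt K d B A]pair_wgtC PAB.
rewrite (@eq_sumz L (pair_wgt K d B) (fun X : letter => - pair_wgt K d A X)) // sumzN.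
suff -> : sumz L (fun X : letter => sumz K (pair_wgt K d X)) =
  sumz L (fun X : letter => sumz L (pair_wgt L d0 X)) by rewrite /=; lia.
apply: eq_sumz => X XL; rewrite !sumz_cons -/K pair_wgtC [pair_wgt K d X B]pair_wgtC PN //.
rewrite (@eq_sumz L _ (pair_wgt L d0 X)); first by ring.
by move=> Y YL; rewrite /pair_wgt /side !E0 // !complementary_idx.
Qed.
End Complementary.

(** The effect of H3: exactly six entries among [A], [B] and [C] change sign.  They
    cancel pairwise in every index and in every intersection number, because the
    exchanged occurrences are adjacent as seen from the other letters. *)
Section Triangle.
Local Open Scope Z_scope.
Variables (L : seq letter) (A B C : letter) (s : bool).
Variables d d' : letter -> letter * bool -> Z.
Let K := [:: A, B, C & L].
Let g : Z := if s then 1 else -1.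

(** The entries that relate [A], [B] and [C] to the other letters. *)
Hypothesis EL : {in L, forall X Y t, Y \in K -> d' X (Y, t) = d X (Y, t)}.
Hypothesis EX : {in L, forall X Y t, Y \in K -> d' Y (X, t) = d Y (X, t)}.
Hypothesis LAB : {in L, forall X, d X (A, s) = d X (B, s)}.
Hypothesis LAC : {in L, forall X, d X (A, ~~ s) = d X (C, s)}.
Hypothesis LBC : {in L, forall X, d X (B, ~~ s) = d X (C, ~~ s)}.
Hypothesis BAC : {in L, forall X t, d B (X, t) = d A (X, t) + d C (X, t) + g}.

(** The entries among [A], [B] and [C], before and after the move. *)
Definition triangle_before (d : letter -> letter * bool -> Z) (g : Z) : Prop :=
  [/\ (forall t, d A (A, t) = 0), (forall t, d B (B, t) = 0), (forall t, d C (C, t) = 0),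
      [/\ d A (B, s) = g, d A (B, ~~ s) = - g, d A (C, s) = - g & d A (C, ~~ s) = - g] &
      [/\ d B (A, s) = - g, d B (A, ~~ s) = g, d B (C, s) = g & d B (C, ~~ s) = - g] /\
      [/\ d C (A, s) = - g, d C (A, ~~ s) = - g, d C (B, s) = - g & d C (B, ~~ s) = g]].

Definition triangle_after (d : letter -> letter * bool -> Z) (g : Z) : Prop :=
  [/\ (forall t, d A (A, t) = 0), (forall t, d B (B, t) = 0), (forall t, d C (C, t) = 0),
      [/\ d A (B, s) = - g, d A (B, ~~ s) = - g, d A (C, s) = g & d A (C, ~~ s) = - g] &
      [/\ d B (A, s) = g, d B (A, ~~ s) = g, d B (C, s) = g & d B (C, ~~ s) = g] /\
      [/\ d C (A, s) = - g, d C (A, ~~ s) = g, d C (B, s) = - g & d C (B, ~~ s) = - g]].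

Hypothesis before : triangle_before d g.
Hypothesis after : triangle_after d' g.

Let eqs F G : {in L, F =1 G} -> sumz L F = sumz L G. Proof. exact: eq_sumz. Qed.

Let KA : A \in K. Proof. by rewrite inE eqxx. Qed.
Let KB : B \in K. Proof. by rewrite !inE eqxx orbT. Qed.
Let KC : C \in K. Proof. by rewrite !inE eqxx !orbT. Qed.
Let KL X : X \in L -> X \in K. Proof. by rewrite !inE => ->; rewrite !orbT. Qed.

Lemma triangle_idx X : X \in K -> idx K d' X = idx K d X.
Proof.
move=> XK; rewrite /idx !sumz_cons.
rewrite (@eqs (fun Y => d' X (Y, true) - _) (fun Y : letter => d X (Y, true) - d X (Y, false))); last first.
  by move=> Y YL; rewrite !EX.
move: XK; rewrite !in_cons => /or4P[/eqP->|/eqP->|/eqP->|XL]; last by rewrite !EL.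
all: case: before => bA bB bC [b1 b2 b3 b4] [[b5 b6 b7 b8] [b9 b10 b11 b12]].
all: case: after => aA aB aC [a1 a2 a3 a4] [[a5 a6 a7 a8] [a9 a10 a11 a12]].
all: rewrite ?aA ?aB ?aC ?bA ?bB ?bC; rewrite /g; case: (s) b1 b2 b3 b4 b5 b6 b7 b8 b9 b10 b11 b12
  a1 a2 a3 a4 a5 a6 a7 a8 a9 a10 a11 a12 => /=; lia.
Qed.

(** The loop at [B] is the sum of the loops at [A] and [C]; this is the relation
    under which the cocycle sums to zero in [triangle_pairing]. *)
Lemma triangle_idxB : idx K d B = idx K d A + idx K d C.
Proof.
rewrite /idx !sumz_cons.
rewrite (@eqs (fun Y => d B (Y, true) - _) (fun Y : letter =>
  (d A (Y, true) - d A (Y, false)) + (d C (Y, true) - d C (Y, false)))); last first.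
  by move=> Y YL; rewrite !BAC //; lia.
rewrite sumzD; case: before => bA bB bC [b1 b2 b3 b4] [[b5 b6 b7 b8] [b9 b10 b11 b12]].
rewrite ?bA ?bB ?bC; rewrite /g; case: (s) b1 b2 b3 b4 b5 b6 b7 b8 b9 b10 b11 b12 => /=; lia.
Qed.

Lemma triangle_inter X Y : X \in K -> Y \in K -> inter K d' X Y = inter K d X Y.
Proof.
move=> XK YK; rewrite /inter !sumz_cons.
set S' := sumz L _; set S := sumz L _.
have {S'} -> : S' = S by apply: eqs => Z ZL; rewrite !EX.
move: S => S.
case: before => bA bB bC [b1 b2 b3 b4] [[b5 b6 b7 b8] [b9 b10 b11 b12]].
case: after => aA aB aC [a1 a2 a3 a4] [[a5 a6 a7 a8] [a9 a10 a11 a12]].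
have LE Z : Z \in L -> [/\ d Z (A, s) = d Z (B, s), d Z (A, ~~ s) = d Z (C, s) &
    d Z (B, ~~ s) = d Z (C, ~~ s)] by move=> ZL; rewrite LAB ?LAC ?LBC.
move: XK YK; rewrite !in_cons => /or4P[/eqP->|/eqP->|/eqP->|XL] /or4P[/eqP->|/eqP->|/eqP->|YL].
all: rewrite ?[d' X _]EL ?[d' Y _]EL //.
all: try case: (LE _ XL) => x1 x2 x3; try case: (LE _ YL) => y1 y2 y3.
all: rewrite ?aA ?aB ?aC ?bA ?bB ?bC.
all: move: b1 b2 b3 b4 b5 b6 b7 b8 b9 b10 b11 b12 a1 a2 a3 a4 a5 a6 a7 a8 a9 a10 a11 a12; rewrite /g.
all: try move: x1 x2 x3; try move: y1 y2 y3.
all: case: (s) => /=; repeat (let H := fresh in intro H; try rewrite H; clear H); rewrite /letter; lia.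
Qed.

Lemma triangle_refined W : refined K d' W = refined K d W.
Proof.
apply: (@refined_eq _ _ _ _ _ id); rewrite ?map_id //; first exact: triangle_idx.
by move=> X Y XK YK; apply: triangle_inter.
Qed.

Lemma triangle_pairing : pairing K d' = pairing K d.
Proof.
have PE X Y : (X \in K) -> (Y \in K) -> (X \in L) || (Y \in L) -> pair_wgt K d' X Y = pair_wgt K d X Y.
  move=> XK YK XYL; rewrite /pair_wgt /side !triangle_idx //.
  by case/orP: XYL => H; [rewrite ![d' X _]EL // ![d' Y _]EX | rewrite ![d' X _]EX // ![d' Y _]EL].
have block Y : Y \in [:: A; B; C] -> pair_wgt K d' Y Y = 0 /\ pair_wgt K d Y Y = 0.
  case: before after => bA bB bC _ _ [aA aB aC _ _]; rewrite !in_cons in_nil orbF.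
  by case/or3P=> /eqP ->; rewrite /pair_wgt /side ?aA ?aB ?aC ?bA ?bB ?bC.
(* Before the move only A and C are unlinked, after it only A, B and B, C are; the
   two sides differ by the sum of the cocycle over a triangle. *)
have AB : pair_wgt K d' A B + pair_wgt K d' A C + pair_wgt K d' B C =
          pair_wgt K d A B + pair_wgt K d A C + pair_wgt K d B C.
  rewrite /pair_wgt /side !triangle_idx // triangle_idxB.
  case: before => _ _ _ [b1 b2 b3 b4] [[b5 b6 b7 b8] [b9 b10 b11 b12]].
  case: after => _ _ _ [a1 a2 a3 a4] [[a5 a6 a7 a8] [a9 a10 a11 a12]].
  move: (idx K d A) (idx K d C) => a c.
  move: b1 b2 b3 b4 b5 b6 b7 b8 b9 b10 b11 b12 a1 a2 a3 a4 a5 a6 a7 a8 a9 a10 a11 a12; rewrite /g.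
  by case: (s) => /=; repeat (let H := fresh in intro H; try rewrite H; clear H); rewrite /cocycle; ring.
have LL : sumz L (fun X => sumz K (pair_wgt K d' X)) = sumz L (fun X => sumz K (pair_wgt K d X)).
  by apply: eqs => X XL; apply: eq_sumz => Y YK; apply: PE; rewrite ?XL // KL.
have RL Y : Y \in K -> sumz L (pair_wgt K d' Y) = sumz L (pair_wgt K d Y).
  by move=> YK; apply: eqs => X XL; apply: PE; rewrite ?XL ?orbT // KL.
rewrite /pairing; rewrite 3!sumz_cons LL [RHS]sumz_cons [in RHS]sumz_cons [in RHS]sumz_cons.
rewrite /K !sumz_cons -/K !RL //.
have [-> ->] := block A (mem_head _ _).
have [-> ->] : pair_wgt K d' B B = 0 /\ pair_wgt K d B B = 0 by apply: block; rewrite !inE eqxx orbT.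
have [-> ->] : pair_wgt K d' C C = 0 /\ pair_wgt K d C C = 0 by apply: block; rewrite !inE eqxx !orbT.
rewrite ![pair_wgt K _ B A]pair_wgtC ![pair_wgt K _ C A]pair_wgtC ![pair_wgt K _ C B]pair_wgtC.
lia.
Qed.
End Triangle.

(** * The effect of the moves on codes *)

Section MoveData.
Local Open Scope Z_scope.

(** The three situations created by H1, H2 and H3, with the hypotheses of the
    sections above. *)
Definition isolated_letter (L : seq letter) (A : letter)
    (d d0 : letter -> letter * bool -> Z) : Prop :=
  [/\ {in L &, forall X Y s, d X (Y, s) = d0 X (Y, s)},
      {in L, forall X, d X (A, true) = d X (A, false)},
      {in L, forall X, d A (X, true) = d A (X, false)} &
      forall s, d A (A, s) = 0].

Definition complementary_letters (L : seq letter) (A B : letter) (u : Z)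
    (d d0 : letter -> letter * bool -> Z) : Prop :=
  [/\ {in L &, forall X Y s, d X (Y, s) = d0 X (Y, s)},
      {in L, forall X s, d X (B, s) = d X (A, ~~ s)},
      {in L, forall X s, d B (X, s) = - d A (X, s)},
      (forall s, d A (A, s) = 0) /\ (forall s, d B (B, s) = 0) &
      (forall s, d A (B, s) = u) /\ (forall s, d B (A, s) = u)].

Definition triangle_letters (L : seq letter) (A B C : letter) (s : bool)
    (d d' : letter -> letter * bool -> Z) : Prop :=
  let K := [:: A, B, C & L] in let g := if s then 1 else -1 in
  [/\ {in L, forall X Y t, Y \in K -> d' X (Y, t) = d X (Y, t)} /\
      {in L, forall X Y t, Y \in K -> d' Y (X, t) = d Y (X, t)},
      [/\ {in L, forall X, d X (A, s) = d X (B, s)},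
          {in L, forall X, d X (A, ~~ s) = d X (C, s)} &
          {in L, forall X, d X (B, ~~ s) = d X (C, ~~ s)}],
      {in L, forall X t, d B (X, t) = d A (X, t) + d C (X, t) + g},
      triangle_before A B C s d g & triangle_after A B C s d' g].

Definition letters (c : code) : seq letter := [seq p.1 | p <- c & p.2].

(** The side of [p] with respect to the arrow [A]; only the cyclic order of the
    positions matters. *)
Definition delta (c : code) (A : letter) (p : letter * bool) : Z :=
  if p.1 == A then 0 else cyc (index (A, true) c) (index p c) (index (A, false) c).

Lemma mem_letters c X : wf c -> (X \in letters c) = (X \in unsign c).
Proof.
move=> W; rewrite -(wf_mem _ true W); apply/mapP/idP => [[[Y s]]|Xc].
  by rewrite mem_filter /= => /andP[/= ->] + ->.
by exists (X, true) => //; rewrite mem_filter.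
Qed.

Lemma letters_relabel f c : letters (relabel f c) = map f (letters c).
Proof. by rewrite /letters filter_map -!map_comp. Qed.

Lemma letters_perm c d : perm_eq c d -> perm_eq (letters c) (letters d).
Proof. by move=> P; apply: perm_map; apply: perm_filter. Qed.

Lemma letters_cons2 A s c : letters [:: (A, s), (A, ~~ s) & c] = A :: letters c.
Proof. by case: s. Qed.

Lemma delta_relabel f c : wf c -> {in unsign c &, injective f} ->
  {in letters c &, forall X Y s, delta (relabel f c) (f X) (f Y, s) = delta c X (Y, s)}.
Proof.
move=> W If X Y; rewrite !mem_letters // => Xc Yc s; rewrite /delta /=.
have H t Z : Z \in unsign c -> index (f Z, t) (relabel f c) = index (Z, t) c.
  move=> Zc; have: {in unsign c, forall X1, (f X1 == f Z) = (X1 == Z)}.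
    by move=> X1 X1c; apply/eqP/eqP => [/If|->//]; apply.
  elim: c {W If Xc Yc Zc} => //= -[X1 s1] c IH HZ; rewrite !xpair_eqE /=.
  by rewrite HZ ?mem_head // IH // => X2 X2c; apply: HZ; rewrite in_cons X2c orbT.
rewrite !H //; have -> // : (f Y == f X) = (Y == X).
by apply/eqP/eqP => [/If|->//]; apply.
Qed.

(** A rotation adds constants to the positions on the two sides of the cut, which
    preserves cyclic orientations. *)
Lemma delta_rot k c : wf c ->
  {in letters c &, forall X Y s, delta (rot k c) X (Y, s) = delta c X (Y, s)}.
Proof.
move=> W X Y; rewrite !mem_letters // => Xc Yc s; rewrite /delta /=; case: eqP => // _.
pose u := take k c; pose v := drop k c; have Ec : c = u ++ v by rewrite cat_take_drop.
have Er : rot k c = v ++ u by [].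
have H p : p \in c -> (index p c < size u /\ index p (rot k c) = size v + index p c \/
     size u <= index p c /\ index p (rot k c) < size v /\
     index p c = size u + index p (rot k c))%N.
  have := wf_uniq W; rewrite Er [in X in X -> _]Ec cat_uniq => /and3P[_ /hasPn D _].
  rewrite [in X in X -> _]Ec mem_cat [in index p c]Ec !index_cat.
  have [pu|pu /= pv] := boolP (p \in u).
    have -> : (p \in v) = false by apply/negP => /D; rewrite /= pu.
    by left; rewrite index_mem.
  by right; rewrite pv index_mem leq_addr.
have := H (X, true); have := H (X, false); have := H (Y, s).
rewrite !wf_mem // Xc Yc => /(_ isT) H1 /(_ isT) H2 /(_ isT) H3.
move: (index (X, true) c) (index (Y, s) c) (index (X, false) c) (index (X, true) (rot k c))
  (index (Y, s) (rot k c)) (index (X, false) (rot k c)) (size u) (size v) H1 H2 H3.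
by clear; rewrite /cyc; lia.
Qed.

(** Inserting two entries shifts the positions beyond them, monotonically. *)
Lemma index_skip (y z : code) a b p : p != a -> p != b ->
  index p (y ++ [:: a, b & z]) =
  (if index p (y ++ z) < size y then index p (y ++ z) else (index p (y ++ z)).+2)%N.
Proof.
move=> pa pb; rewrite !index_cat /= ![_ == p]eq_sym (negPf pa) (negPf pb).
have [py|py] := boolP (p \in y); first by rewrite index_mem py.
by rewrite ltnNge leq_addr /= !addnS.
Qed.

Lemma index_new (y z : code) p : p \notin y -> index p (y ++ p :: z) = size y.
Proof. by move=> py; rewrite index_cat (negPf py) /= eqxx addn0. Qed.

Lemma index_skip1 (c : code) A s X t : X != A -> index (X, t) ((A, s) :: c) = (index (X, t) c).+1.
Proof. by move=> /negPf XA; rewrite /= xpair_eqE eq_sym XA. Qed.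

Lemma notin_letters c A X : wf c -> A \notin unsign c -> X \in letters c -> X != A.
Proof. by move=> W nA; rewrite mem_letters //; apply: contraTneq => ->. Qed.

Lemma isolated_H1 A s y : wf [:: (A, s), (A, ~~ s) & y] ->
  isolated_letter (letters y) A (delta [:: (A, s), (A, ~~ s) & y]) (delta y).
Proof.
rewrite wf_cons2 => /andP[nA W]; have ne X := @notin_letters y A X W nA.
set c := [:: _, _ & _].
have E X t : X \in letters y -> index (X, t) c = (index (X, t) y).+2.
  by move=> /ne XA; rewrite !index_skip1.
have iA : index (A, s) c = 0%N by rewrite /= eqxx.
have iA' : index (A, ~~ s) c = 1%N.
  by rewrite /= xpair_eqE !eqxx; case: (s).
clearbody c; split=> [X Y Xy Yy t|X Xy|X Xy|t]; rewrite /delta /= ?eqxx //.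
- by case: eqP => // _; rewrite !E // /cyc; lia.
- rewrite eq_sym (negPf (ne _ Xy)) !(E X) //.
  have /negPf XA := ne _ Xy.
  by case: (s) iA iA' => /= -> ->; rewrite /cyc; lia.
- rewrite (negPf (ne _ Xy)) !(E X) //.
  by case: (s) iA iA' => /= -> ->; rewrite /cyc; lia.
Qed.

Lemma complementary_H2 A B s y z :
  wf [:: (A, s), (B, ~~ s) & y ++ [:: (B, s), (A, ~~ s) & z]] ->
  complementary_letters (letters (y ++ z)) A B (if s then 1 else -1)
    (delta [:: (A, s), (B, ~~ s) & y ++ [:: (B, s), (A, ~~ s) & z]]) (delta (y ++ z)).
Proof.
set c := [:: _, _ & _] => Wc; have /and4P[AB nA nB W] : [&& A != B, A \notin unsign (y ++ z), B \notin unsign (y ++ z) & wf (y ++ z)].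
  by rewrite -(wf_cons4 _ s _ s); apply: wf_perm Wc; by_perm.
clear Wc; have neA X := @notin_letters _ A X W nA; have neB X := @notin_letters _ B X W nB.
have E X t : X \in letters (y ++ z) -> index (X, t) c =
    (if index (X, t) (y ++ z) < size y then (index (X, t) (y ++ z)).+2 else (index (X, t) (y ++ z)).+4)%N.
  move=> Xyz; rewrite !index_skip1 ?neA ?neB // index_skip ?xpair_eqE ?negb_and ?neA ?neB //.
  by case: ifP.
have [iA iB iB' iA'] : [/\ index (A, s) c = 0, index (B, ~~ s) c = 1,
    index (B, s) c = (size y).+2 & index (A, ~~ s) c = (size y).+3]%N.
  have ny X t : X \notin unsign (y ++ z) -> (X, t) \notin y.
    by rewrite /unsign map_cat mem_cat negb_or => /andP[nX _]; apply: contra nX => /unsign_mem.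
  have ss : (s == ~~ s) = false by case: (s).
  rewrite /c; split; first by rewrite /= eqxx.
  - by rewrite index_skip1 1?eq_sym //= eqxx.
  - by rewrite index_skip1 1?eq_sym //= xpair_eqE eqxx eq_sym ss /= index_new ?ny.
  - rewrite /= !xpair_eqE eqxx ss /= eq_sym (negPf AB) /=.
    by rewrite -cat_rcons index_new ?size_rcons // mem_rcons in_cons xpair_eqE (negPf AB) ny.
clearbody c; split=> [X Y Xy Yy t|X Xy t|X Xy t||]; rewrite /delta /=.
- case: eqP => // _; rewrite !E //; clear; move: (index _ _) (index _ _) (index _ _) (size _) => i j k n.
  by do 3!case: ltnP => ?; rewrite /cyc; lia.
- rewrite ![_ == X]eq_sym (negPf (neA _ Xy)) (negPf (neB _ Xy)) !(E X) //.
  case: (s) t iA iA' iB iB' => -[] /= a1 a2 a3 a4; rewrite ?a1 ?a2 ?a3 ?a4;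
  clear; move: (size _) => n; move: (index _ _) => i; move: (index _ _) => j;
  do 2!case: ltnP => ?; rewrite /cyc; lia.
- rewrite (negPf (neA _ Xy)) (negPf (neB _ Xy)) !(E X) //.
  case: (s) t iA iA' iB iB' => -[] /= a1 a2 a3 a4; rewrite ?a1 ?a2 ?a3 ?a4;
  clear; move: (size _) => n; move: (index _ _) => i; by case: ltnP => ?; rewrite /cyc; lia.
- by split=> t; rewrite eqxx.
- split=> t; rewrite ?[B == A]eq_sym (negPf AB);
  case: (s) t iA iA' iB iB' => -[] /= a1 a2 a3 a4; rewrite ?a1 ?a2 ?a3 ?a4;
  clear; move: (size _) => n; rewrite /cyc; lia.
Qed.

(* Generalizing the positions first keeps the arithmetic goal small. *)
Ltac cyc_lia :=
  repeat match goal with |- context [index ?p ?c] => move: (index p c) => ? end;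
  clear; rewrite /cyc; intros; lia.

Lemma index_at (c u v : code) p n : uniq c -> c = u ++ p :: v -> size u = n -> index p c = n.
Proof.
move=> + E <-; rewrite E cat_uniq /= => /and3P[_ /norP[pu _] _]; exact: index_new.
Qed.

(** All positions are explicit: the three exchanged pairs start at positions 0,
    [m + 2] and [m + k + 4], and every other occurrence keeps its position. *)
Lemma triangle_H3 A B C s y z t :
  let c := [:: (A, s), (B, s) & y ++ [:: (A, ~~ s), (C, s) & z ++
                 [:: (B, ~~ s), (C, ~~ s) & t]]] in
  let c' := [:: (B, s), (A, s) & y ++ [:: (C, s), (A, ~~ s) & z ++
                 [:: (C, ~~ s), (B, ~~ s) & t]]] in
  wf c -> triangle_letters (letters (y ++ z ++ t)) A B C s (delta c) (delta c').
Proof.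
move=> c c' Wc; have Wc' : wf c' := code_move_wf (CH3 _ _ _ _ _ _ _) Wc.
have [nAB nAC nBC] : [/\ A != B, A != C & B != C].
  by split; apply/eqP => E; move: (wf_uniq Wc);
    rewrite /c E /= !(mem_cat, inE) eqxx ?orbT ?andbF.
have W6 : wf ([:: (A, s), (A, ~~ s), (B, s), (B, ~~ s) & [:: (C, s), (C, ~~ s) & y ++ z ++ t]]).
  by apply: wf_perm Wc; by_perm.
have [nA nB nC W] : [/\ A \notin unsign (y ++ z ++ t), B \notin unsign (y ++ z ++ t),
    C \notin unsign (y ++ z ++ t) & wf (y ++ z ++ t)].
  move: W6; rewrite wf_cons4 => /and4P[_]; rewrite /= !in_cons !negb_or => /and3P[_ _ nA].
  by move=> /and3P[_ _ nB]; rewrite wf_cons2 => /andP[].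
have neA X := @notin_letters _ A X W nA; have neB X := @notin_letters _ B X W nB.
have neC X := @notin_letters _ C X W nC.
have nL : [/\ A \notin letters (y ++ z ++ t), B \notin letters (y ++ z ++ t) &
  C \notin letters (y ++ z ++ t)] by rewrite !mem_letters.
pose m := size y; pose k := size z; pose L := letters (y ++ z ++ t).
have E X u : X \in L -> index (X, u) c' = index (X, u) c /\
    (index (X, u) c <> 0 /\ index (X, u) c <> 1 /\ index (X, u) c <> m + 2 /\
     index (X, u) c <> m + 3 /\ index (X, u) c <> m + k + 4 /\ index (X, u) c <> m + k + 5)%N.
  move=> XL; rewrite !index_skip1 ?neA ?neB // !index_skip ?xpair_eqE ?negb_and ?neA ?neB ?neC //.
  rewrite !catA !index_skip ?xpair_eqE ?negb_and ?neA ?neB ?neC // -catA size_cat -/m -/k.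
  move: (index _ _) => q; clear; split=> //.
  by case: (ltnP q (m + k)) => ?; case: ltnP => ?; lia.
have U := wf_uniq Wc; have U' := wf_uniq Wc'.
have [p1 p2] : index (A, s) c = 0%N /\ index (B, s) c = 1%N.
  by split; [exact: (@index_at _ [::] _ _ _ U) | exact: (@index_at _ [:: (A, s)] _ _ _ U)].
have [p1' p2'] : index (B, s) c' = 0%N /\ index (A, s) c' = 1%N.
  by split; [exact: (@index_at _ [::] _ _ _ U') | exact: (@index_at _ [:: (B, s)] _ _ _ U')].
have [p3 p4] : index (A, ~~ s) c = (m + 2)%N /\ index (C, s) c = (m + 3)%N.
  split; first by apply: (@index_at _ [:: (A, s), (B, s) & y] _ _ _ U) => //=; rewrite /m; clear; lia.
  apply: (@index_at _ ([:: (A, s), (B, s) & y] ++ [:: (A, ~~ s)]) _ _ _ U); first by rewrite -catA.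
  by rewrite size_cat /= /m; clear; lia.
have [p3' p4'] : index (C, s) c' = (m + 2)%N /\ index (A, ~~ s) c' = (m + 3)%N.
  split; first by apply: (@index_at _ [:: (B, s), (A, s) & y] _ _ _ U') => //=; rewrite /m; clear; lia.
  apply: (@index_at _ ([:: (B, s), (A, s) & y] ++ [:: (C, s)]) _ _ _ U'); first by rewrite -catA.
  by rewrite size_cat /= /m; clear; lia.
have [p5 p6] : index (B, ~~ s) c = (m + k + 4)%N /\ index (C, ~~ s) c = (m + k + 5)%N.
  split.
    apply: (@index_at _ ([:: (A, s), (B, s) & y] ++ [:: (A, ~~ s), (C, s) & z]) _ _ _ U).
      by rewrite -catA.
    by rewrite size_cat /= /m /k; clear; lia.
  apply: (@index_at _ ([:: (A, s), (B, s) & y] ++ [:: (A, ~~ s), (C, s) & z] ++ [:: (B, ~~ s)]) _ _ _ U).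
    by rewrite -!catA.
  by rewrite !size_cat /= /m /k; clear; lia.
have [p5' p6'] : index (C, ~~ s) c' = (m + k + 4)%N /\ index (B, ~~ s) c' = (m + k + 5)%N.
  split.
    apply: (@index_at _ ([:: (B, s), (A, s) & y] ++ [:: (C, s), (A, ~~ s) & z]) _ _ _ U').
      by rewrite -catA.
    by rewrite size_cat /= /m /k; clear; lia.
  apply: (@index_at _ ([:: (B, s), (A, s) & y] ++ [:: (C, s), (A, ~~ s) & z] ++ [:: (C, ~~ s)]) _ _ _ U').
    by rewrite -!catA.
  by rewrite !size_cat /= /m /k; clear; lia.
rewrite -/L in neA neB neC nL *.
have Es (u : bool) : u = (if u == s then s else ~~ s) by case: (u); case: (s).
have qA u : index (A, u) c = if u == s then 0%N else (m + 2)%N by rewrite {1}(Es u); case: ifP.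
have qB u : index (B, u) c = if u == s then 1%N else (m + k + 4)%N by rewrite {1}(Es u); case: ifP.
have qC u : index (C, u) c = if u == s then (m + 3)%N else (m + k + 5)%N by rewrite {1}(Es u); case: ifP.
have qA' u : index (A, u) c' = if u == s then 1%N else (m + 3)%N by rewrite {1}(Es u); case: ifP.
have qB' u : index (B, u) c' = if u == s then 0%N else (m + k + 5)%N by rewrite {1}(Es u); case: ifP.
have qC' u : index (C, u) c' = if u == s then (m + 2)%N else (m + k + 4)%N by rewrite {1}(Es u); case: ifP.
have nX X : X \in L -> [/\ (X == A) = false, (X == B) = false, (X == C) = false,
    (A == X) = false & (B == X) = false /\ (C == X) = false].
  by move=> XL; rewrite ![_ == X]eq_sym !(negPf (neA _ XL)) !(negPf (neB _ XL)) !(negPf (neC _ XL)).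
clearbody c c' m k L; clear Wc Wc' U U' W W6 nA nB nC p1 p2 p3 p4 p5 p6 p1' p2' p3' p4' p5' p6' Es.
rewrite /triangle_letters; split; first split.
- move=> X XL Y u YK; rewrite /delta /=; case: eqP => // XY.
  have [-> N1] := E _ true XL; have [-> N2] := E _ false XL; move: N1 N2.
  move: YK; rewrite !in_cons => /or4P[/eqP->|/eqP->|/eqP->|YL].
  + by rewrite qA qA'; case: (u == s); cyc_lia.
  + by rewrite qB qB'; case: (u == s); cyc_lia.
  + by rewrite qC qC'; case: (u == s); cyc_lia.
  + by have [-> _] := E _ u YL.
- move=> X XL Y u YK; rewrite /delta /=; case: eqP => // XY.
  have [-> N1] := E _ u XL; move: N1.
  move: YK; rewrite !in_cons => /or4P[/eqP->|/eqP->|/eqP->|YL].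
  + by rewrite !qA !qA'; case: (s) => /=; cyc_lia.
  + by rewrite !qB !qB'; case: (s) => /=; cyc_lia.
  + by rewrite !qC !qC'; case: (s) => /=; cyc_lia.
  + by have [-> _] := E _ true YL; have [-> _] := E _ false YL.
- split=> X XL; have [_ N1] := E _ true XL; have [_ N2] := E _ false XL; move: N1 N2;
  have [_ _ _ n1 [n2 n3]] := nX _ XL; rewrite /delta /= ?n1 ?n2 ?n3 ?qA ?qB ?qC;
  by case: (s) => /=; cyc_lia.
- move=> X XL u; have [_ N1] := E _ u XL; move: N1.
  have [n1 n2 n3 _ _] := nX _ XL; rewrite /delta /= ?n1 ?n2 ?n3 !qA !qB !qC.
  by case: (s) => /=; cyc_lia.
- have [BA CA CB] : [/\ B != A, C != A & C != B] by rewrite ![_ == A]eq_sym [C == B]eq_sym.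
  split; first [by move=> u; rewrite /delta /= eqxx | split; [split | split] | split];
  rewrite /delta /= ?(negPf nAB) ?(negPf nAC) ?(negPf nBC) ?(negPf BA) ?(negPf CA) ?(negPf CB);
  rewrite ?qA ?qB ?qC; case: (s) => /=; cyc_lia.
- have [BA CA CB] : [/\ B != A, C != A & C != B] by rewrite ![_ == A]eq_sym [C == B]eq_sym.
  split; first [by move=> u; rewrite /delta /= eqxx | split; [split | split] | split];
  rewrite /delta /= ?(negPf nAB) ?(negPf nAC) ?(negPf nBC) ?(negPf BA) ?(negPf CA) ?(negPf CB);
  rewrite ?qA' ?qB' ?qC'; case: (s) => /=; cyc_lia.
Qed.
End MoveData.

(** * Homotopy invariants *)

Section StructuralInvariants.
Local Open Scope Z_scope.

Section Structural.
Variable J : seq letter -> (letter -> letter * bool -> Z) -> Z.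
Hypothesis J_perm : forall L L' d, perm_eq L L' -> J L d = J L' d.
Hypothesis J_relabel : forall L d d' f,
  {in L &, forall X Y s, d' (f X) (f Y, s) = d X (Y, s)} -> J (map f L) d' = J L d.
Hypothesis J_isolated : forall L A d d0, isolated_letter L A d d0 -> J (A :: L) d = J L d0.
Hypothesis J_complementary : forall L A B u d d0, complementary_letters L A B u d d0 ->
  J [:: A, B & L] d = J L d0.
Hypothesis J_triangle : forall L A B C s d d', triangle_letters L A B C s d d' ->
  J [:: A, B, C & L] d = J [:: A, B, C & L] d'.

(** Any function of the sides that is compatible with the three algebraic situations
    created by H1, H2 and H3 is invariant under the moves. *)
Lemma structural_invariant c d : wf c -> code_move c d ->
  J (letters c) (delta c) = J (letters d) (delta d).
Proof.
move=> W cd; case: cd W => [f {}c If|k {}c|A s y|A B s y z|A B C s y z t] W.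
- by rewrite letters_relabel; apply/esym/J_relabel; apply: delta_relabel.
- rewrite -(J_perm (delta (rot k c)) (letters_perm (_ : perm_eq c (rot k c)))); last first.
    by rewrite perm_sym perm_rot.
  rewrite -[in RHS](map_id (letters c)); apply/esym/J_relabel => X Y Xc Yc s.
  exact: delta_rot.
- by rewrite letters_cons2; apply: J_isolated; apply: isolated_H1.
- rewrite (@J_perm _ [:: A, B & letters (y ++ z)]).
    by apply: J_complementary; apply: complementary_H2.
  rewrite -(letters_cons2 B s) -(letters_cons2 A s); apply: letters_perm; by_perm.
- rewrite (@J_perm _ [:: A, B, C & letters (y ++ z ++ t)]).
    rewrite (J_triangle (triangle_H3 W)); apply/esym/J_perm.
    rewrite -(letters_cons2 C s) -(letters_cons2 B s) -(letters_cons2 A s).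
    by apply: letters_perm; by_perm.
  rewrite -(letters_cons2 C s) -(letters_cons2 B s) -(letters_cons2 A s).
  by apply: letters_perm; by_perm.
Qed.
End Structural.

Lemma idx_relabel L d d' f A : {in L &, forall X Y s, d' (f X) (f Y, s) = d X (Y, s)} ->
  A \in L -> idx (map f L) d' (f A) = idx L d A.
Proof. by move=> E AL; rewrite /idx sumz_map; apply: eq_sumz => X XL /=; rewrite !E. Qed.

Lemma refined_invariant W c d : odd_weight W -> wf c -> code_move c d ->
  refined (letters c) (delta c) W = refined (letters d) (delta d) W.
Proof.
move=> OW; apply: (@structural_invariant (fun L d => refined L d W)) => {c d}.
- by move=> L L' d P /=; apply: refined_perm.
- move=> L d d' f E; apply: (@refined_eq _ _ _ _ _ f) => // [A AL|A B AL BL].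
    exact: idx_relabel.
  by rewrite /inter sumz_map; apply: eq_sumz => X XL /=; rewrite !E.
- by move=> L A d d0 [*]; apply: isolated_refined.
- by move=> L A B u d d0 [E0 EB BE [AA BB] [AB BA]]; apply: (complementary_refined (u := u)).
- by move=> L A B C s d d' [[EL EX] [LAB LAC LBC] BAC b a]; apply/esym/(triangle_refined (s := s)).
Qed.

Lemma pairing_invariant c d : wf c -> code_move c d ->
  pairing (letters c) (delta c) = pairing (letters d) (delta d).
Proof.
apply: structural_invariant => {c d}.
- by move=> L L' d P /=; apply: pairing_perm.
- move=> L d d' f E; rewrite /pairing sumz_map; apply: eq_sumz => A AL /=.
  rewrite sumz_map; apply: eq_sumz => B BL /=.
  by rewrite /pair_wgt /side !(idx_relabel E) // !E.
- by move=> L A d d0 [*]; apply: isolated_pairing.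
- by move=> L A B u d d0 [E0 EB BE [AA BB] [AB BA]]; apply: (complementary_pairing (u := u)).
- by move=> L A B C s d d' [[EL EX] [LAB LAC LBC] BAC b a]; apply/esym/(triangle_pairing (s := s)).
Qed.

(** The first three values separate the tabulated nanowords except on the word
    ABACBDCD, where they agree for the types aaab and bbba, for the types abbb and
    baaa, and for the types abab and baba, which they do not separate from the empty
    nanoword either; there the pairing decides. *)
Definition invariants (n : nanoword) : seq Z :=
  let L := letters (code_of n) in let d := delta (code_of n) in
  [:: refined L d (fun n _ _ => n * n * n); refined L d (fun n e _ => n * e);
      refined L d (fun n e h => n * n * e * h); pairing L d].

Lemma homotopic_invariants m n : homotopic m n -> invariants m = invariants n.
Proof.
move=> mn; have H W (OW : odd_weight W) := homotopic_invariant (I := fun c => refined (letters c) (delta c) W)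
  (fun c d => @refined_invariant W c d OW) mn.
have P := homotopic_invariant (I := fun c => pairing (letters c) (delta c)) pairing_invariant mn.
by rewrite /invariants P !H //; split=> *; ring.
Qed.

End StructuralInvariants.

(** * Reduction to the table *)

Lemma homotopic_sym m n : homotopic m n -> homotopic n m.
Proof. exact: rst_sym. Qed.

Lemma homotopic_trans m n p : homotopic m n -> homotopic n p -> homotopic m p.
Proof. exact: rst_trans. Qed.

Lemma fresh_letter (w : seq letter) : exists N, N \notin w.
Proof.
have le X : X \in w -> X <= sumn w.
  elim: w => //= Y w IH; rewrite in_cons => /orP[/eqP->|/IH H]; first exact: leq_addr.
  exact: leq_trans H (leq_addl _ _).
by exists (sumn w).+1; apply/negP => /le; rewrite ltnn.
Qed.

(** A variant of H2, with strands running in the same direction.  An isolated letter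
    [N] between [A] and [B] creates a triangle; H3 across it turns [A] and [B]
    into a pair removed by H2, after which [N] is isolated again.  Removing such
    pairs makes it unnecessary to pass through words with more letters when words
    with at most four letters are sorted. *)
Lemma homotopic_parallel A B s y z :
  wf [:: (A, s), (B, ~~ s) & y ++ [:: (A, ~~ s), (B, s) & z]] ->
  wf (y ++ z) /\
  homotopic (nano [:: (A, s), (B, ~~ s) & y ++ [:: (A, ~~ s), (B, s) & z]]) (nano (y ++ z)).
Proof.
set c := [:: _, _ & _] => W; have [N nN] := fresh_letter (unsign c).
pose c0 := [:: (N, s), (N, ~~ s), (B, ~~ s) & y ++ [:: (A, ~~ s), (B, s) & z ++ [:: (A, s)]]].
have Ec : rot 1 c = behead (behead c0) by rewrite rot1_cons -cats1 /= -catA.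
have W0 : wf c0 by rewrite wf_cons2 -[_ :: _]/(behead (behead c0)) -Ec wf_rot W andbT
  /unsign map_rot mem_rot.
pose c1 := [:: (B, ~~ s), (N, ~~ s) & y ++ [:: (B, ~~ ~~ s), (A, ~~ s) & z ++
                 [:: (N, ~~ ~~ s), (A, ~~ ~~ s) & [::]]]].
have M1 : code_move c1 (rot 1 c0).
  rewrite rot1_cons -cats1 /= -catA /= -catA /c1; have := CH3 B N A (~~ s) y z [::].
  by rewrite negbK.
have W1 : wf c1 by apply: wf_perm W0; rewrite /c1 negbK; by_perm.
pose c2 := [:: (A, s), (B, ~~ s) & ((N, ~~ s) :: y) ++ [:: (B, s), (A, ~~ s) & z ++ [:: (N, s)]]].
have E2 : rot 1 c2 = c1 by rewrite rot1_cons -cats1 /c1 /= !negbK -catA /= -catA.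
have W2 : wf c2 by rewrite -(wf_rot 1) E2.
have M3 := CH2 A B s ((N, ~~ s) :: y) (z ++ [:: (N, s)]).
have W3 := code_move_wf M3 W2.
pose c4 := [:: (N, s), (N, ~~ s) & y ++ z].
have E4 : rot 1 c4 = ((N, ~~ s) :: y) ++ z ++ [:: (N, s)].
  by rewrite rot1_cons -cats1 /= catA.
have W4 : wf c4 by rewrite -(wf_rot 1) E4.
have M5 : code_move c4 (y ++ z) := CH1 _ _ _.
split; first exact: code_move_wf M5 W4.
apply: homotopic_trans (homotopic_nano W (CRot 1 _)) _; rewrite Ec.
apply: homotopic_trans (homotopic_sym (homotopic_nano W0 (CH1 _ _ _))) _.
apply: homotopic_trans (homotopic_nano W0 (CRot 1 _)) _.
apply: homotopic_trans (homotopic_sym (homotopic_nano W1 M1)) _; rewrite -E2.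
apply: homotopic_trans (homotopic_sym (homotopic_nano W2 (CRot 1 _))) _.
apply: homotopic_trans (homotopic_nano W2 M3) _; rewrite -E4.
apply: homotopic_trans (homotopic_sym (homotopic_nano W4 (CRot 1 _))) _.
exact: homotopic_nano M5.
Qed.

Definition flip (p : letter * bool) : letter * bool := (p.1, ~~ p.2).

(** A version of [has] that stops at the first success under call-by-value. *)
Fixpoint some (T : Type) (a : T -> bool) (s : seq T) : bool :=
  if s is x :: s' then if a x then true else some a s' else false.

Lemma someE (T : Type) (a : T -> bool) s : some a s = has a s.
Proof. by elim: s => //= x s ->; case: (a x). Qed.

Definition rots (c : code) : seq code := [seq rot k c | k <- iota 0 (size c).+1].

(** The first two entries can be removed by H1, by H2 or by [homotopic_parallel]. *)
Definition reducible_front (c : code) : bool :=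
  if c is [:: p, q & r] then
    (p.1 == q.1) ||
    (q.2 == ~~ p.2) && (infix [:: flip q; flip p] r || infix [:: flip p; flip q] r)
  else false.

Definition reducible (c : code) : bool := some reducible_front (rots c).

Lemma reducibleP c : wf c -> reducible c ->
  exists d, [/\ wf d, size d < size c & homotopic (nano c) (nano d)].
Proof.
rewrite /reducible someE => W /hasP[_ /mapP[k _ ->]]; rewrite -(size_rot k c) => R.
suff [d [Wd Sd Hd]] : exists d,
    [/\ wf d, size d < size (rot k c) & homotopic (nano (rot k c)) (nano d)].
  by exists d; split=> //; apply: homotopic_trans Hd; apply: homotopic_nano => //; apply: CRot.
move: (rot k c) (wf_rot k c) R; rewrite W => {c W} [] [|[A s] [|[B t] r]] //= W /orP[/eqP E|].
  subst B; have Et : t = ~~ s.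
    have := wf_uniq W; rewrite /= inE negb_or xpair_eqE eqxx /= => /andP[/andP[+ _] _].
    by case: (s) (t) => -[].
  subst t; have M := CH1 A s r; exists r; split; last exact: homotopic_nano.
  + exact: code_move_wf W.
  + by rewrite ltnS leqW.
case/andP=> /eqP Et; subst t; rewrite /flip /= negbK => /orP[] /infixP[y [z E]]; subst r.
  have M := CH2 A B s y z; exists (y ++ z); split; last exact: homotopic_nano.
  + exact: code_move_wf W.
  + by rewrite !size_cat /=; lia.
have [Wd Hd] := homotopic_parallel W.
by exists (y ++ z); split=> //; rewrite !size_cat /=; lia.
Qed.

(** The list contains the result of H3 applied from left to right to a triangle whose
    first exchanged pair is at the start of the code, if there is one. *)
Definition slide_right (c : code) : seq code :=
  if c is [:: p, q & r] then
    let i := index (flip p) r in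
    if drop i r is [:: a, e & r'] then
      let j := index (flip q) r' in
      if drop j r' is [:: b, e' & t] then
        if [&& q.2 == p.2, a == flip p, e.2 == p.2, b == flip q & e' == flip e]
        then [:: [:: q, p & take i r ++ [:: e, a & take j r' ++ [:: e', b & t]]]]
        else [::]
      else [::]
    else [::]
  else [::].

(** The same for H3 applied from right to left; the letter [e] precedes [flip q]. *)
Definition slide_left (c : code) : seq code :=
  if c is [:: p, q & r] then
    let i := (index (flip q) r).-1 in
    if drop i r is [:: e, a & r'] then
      let j := (index (flip p) r').-1 in
      if drop j r' is [:: e', b & t] then
        if [&& q.2 == p.2, a == flip q, e.2 == p.2, b == flip p & e' == flip e]
        then [:: [:: q, p & take i r ++ [:: a, e & take j r' ++ [:: b, e' & t]]]]
        else [::]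
      else [::]
    else [::]
  else [::].

Lemma slide_rightP c d : d \in slide_right c -> perm_eq c d /\ code_move c d.
Proof.
case: c => [|[A s] [|[B s'] r]] //=; have := cat_take_drop (index (flip (A, s)) r) r.
move: (take _ r) (drop _ r) => y [|a [|[C u] r']] //= <-.
have := cat_take_drop (index (flip (B, s')) r') r'.
move: (take _ r') (drop _ r') => z [|b [|e' t]] //= <-.
case: and5P => // -[/eqP /= -> /eqP -> /eqP -> /eqP -> /eqP ->]; rewrite inE => /eqP ->.
by split; [by_perm | exact: CH3].
Qed.

Lemma slide_leftP c d : d \in slide_left c -> perm_eq c d /\ code_move d c.
Proof.
case: c => [|[B s] [|[A s'] r]] //=; have := cat_take_drop (index (flip (A, s')) r).-1 r.
move: (take _ r) (drop _ r) => y [|[C u] [|a r']] //= <-.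
have := cat_take_drop (index (flip (B, s)) r').-1 r'.
move: (take _ r') (drop _ r') => z [|e' [|b t]] //= <-.
case: and5P => // -[/eqP /= -> /eqP -> /eqP -> /eqP -> /eqP ->]; rewrite inE => /eqP ->.
by split; [by_perm | exact: CH3].
Qed.

Definition normalize (c : code) : code := relabel (index^~ (undup (unsign c))) c.

(** Computed once and for all; the codes in the table carry large letters. *)
Definition tabulated_codes : seq code :=
  Eval vm_compute in [seq normalize (code_of n) | n <- table].

Definition tabulated_code (c : code) : bool :=
  some (fun d => let e := normalize d in some (eq_op e) tabulated_codes) (rots c).

Definition settled (c : code) : bool := if reducible c then true else tabulated_code c.

(** A single H3 move suffices to settle the codes that are not settled as they are. *)
Definition checked (c : code) : bool :=
  if settled c then true
  else some (fun d => some settled (slide_right d ++ slide_left d)) (rots c).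

Definition insert_letter (A : letter) (s : bool) (c : code) : seq code :=
  [seq [:: (A, s) & take i c] ++ [:: (A, ~~ s) & drop i c] | i <- iota 0 (size c).+1].

(** All codes on the letters below [k], up to renaming: a code is obtained from a
    smaller one by inserting a letter whose first occurrence is at the front. *)
Fixpoint codes (k : nat) : seq code :=
  if k is k'.+1 then
    flatten [seq insert_letter k' s v | v <- codes k', s <- [:: true; false]]
  else [:: [::]].

Lemma has_In (T : Type) (a : T -> bool) (s : seq T) : has a s -> exists x, List.In x s /\ a x.
Proof.
elim: s => //= x s IH /orP[ax|/IH[y [ys ay]]]; first by exists x; split; [left|].
by exists y; split; [right|].
Qed.

Lemma normalize_inj c : {in unsign c &, injective (index^~ (undup (unsign c)))}.
Proof.
move=> X Y Xc Yc E; rewrite -(nth_index X (s := undup (unsign c)) (x := X)) ?mem_undup //.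
by rewrite E nth_index ?mem_undup.
Qed.

Lemma homotopic_normalize c : wf c -> homotopic (nano c) (nano (normalize c)).
Proof. by move=> W; apply: homotopic_nano => //; apply/CRelabel/normalize_inj. Qed.

Lemma homotopic_nano_code_of n : homotopic n (nano (code_of n)).
Proof. by apply: homotopic_code_eq; rewrite code_of_nano ?wf_code_of. Qed.

Lemma size_code_of n : size (code_of n) = size (nw_word n).
Proof. by rewrite -unsign_code_of size_map. Qed.

Lemma tabulated_codeP c : wf c -> tabulated_code c ->
  exists t, [/\ List.In t table, size (nw_word t) = size c & homotopic (nano c) t].
Proof.
move=> W; rewrite /tabulated_code someE => /hasP[_ /mapP[k _ ->]]; rewrite someE.
have -> : tabulated_codes = [seq normalize (code_of n) | n <- table] by vm_compute.
rewrite has_map => /has_In[t [tT /= /eqP E]]; exists t.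
have Wk : wf (rot k c) by rewrite wf_rot.
have Sn d : size (normalize d) = size d by rewrite size_map.
split=> //; first by rewrite -size_code_of -(Sn (code_of t)) -E Sn size_rot.
apply: homotopic_trans (homotopic_nano W (CRot k _)) _.
apply: homotopic_trans (homotopic_normalize Wk) _; rewrite E.
apply: homotopic_trans (homotopic_sym (homotopic_normalize (wf_code_of t))) _.
exact/homotopic_sym/homotopic_nano_code_of.
Qed.

(** The alternative that drives the induction on the number of letters. *)
Definition simplifiable (c : code) : Prop :=
  (exists d, [/\ wf d, size d < size c & homotopic (nano c) (nano d)]) \/
  (exists t, [/\ List.In t table, size (nw_word t) = size c & homotopic (nano c) t]).

Lemma simplifiable_homotopic c d : size c = size d -> homotopic (nano c) (nano d) ->
  simplifiable d -> simplifiable c.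
Proof.
move=> E H [[e [We Se He]]|[t [tT St Ht]]]; [left; exists e|right; exists t];
  by rewrite E; split=> //; apply: homotopic_trans H _.
Qed.

Lemma settledP c : wf c -> settled c -> simplifiable c.
Proof.
move=> W; rewrite /settled; case: ifP => [R _|_ T]; first by left; apply: reducibleP.
by right; apply: tabulated_codeP.
Qed.

Lemma checkedP c : wf c -> checked c -> simplifiable c.
Proof.
move=> W; rewrite /checked; case: ifP => [S _|_]; first exact: settledP.
rewrite someE => /hasP[_ /mapP[k _ ->]]; rewrite someE.
have Wk : wf (rot k c) by rewrite wf_rot.
have Hk : homotopic (nano c) (nano (rot k c)) := homotopic_nano W (CRot k _).
case/hasP=> d; rewrite mem_cat => dS Sd.
have [Wd Ed Hd] : [/\ wf d, size (rot k c) = size d & homotopic (nano (rot k c)) (nano d)].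
  case/orP: dS => [/slide_rightP|/slide_leftP] [P M]; have Wd := wf_perm P Wk;
    split=> //; rewrite ?(perm_size P) //; first exact: homotopic_nano.
  exact/homotopic_sym/homotopic_nano.
apply: simplifiable_homotopic (settledP Wd Sd); first by rewrite -Ed size_rot.
exact: homotopic_trans Hk Hd.
Qed.

Lemma codes_complete k c : wf c -> size c = k.*2 ->
  exists f : letter -> letter, [/\ {in unsign c &, injective f},
    {in unsign c, forall X, f X < k} & relabel f c \in codes k].
Proof.
elim: k c => [|k IH] c W Sc; first by exists id; case: c Sc {W}.
case: c W Sc => [//|[A s] c W Sc].
have Ac : (A, ~~ s) \in c.
  have: (A, ~~ s) \in (A, s) :: c by rewrite wf_mem //= mem_head.
  by rewrite in_cons xpair_eqE eqxx /=; case: (s).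
case/splitPr: Ac W Sc => [x y] W Sc.
have /andP[nA Wxy] : (A \notin unsign (x ++ y)) && wf (x ++ y).
  by rewrite -(wf_cons2 _ s); apply: wf_perm W; by_perm.
have [|f [If Lf Ef]] := IH _ Wxy; first by move: Sc; rewrite /= !size_cat /=; lia.
pose g X := if X == A then k else f X.
have Hxy X : X \in unsign ((A, s) :: x ++ (A, ~~ s) :: y) -> X != A -> X \in unsign (x ++ y).
  by rewrite /= /unsign !map_cat /= !(in_cons, mem_cat) => + /negPf nX; rewrite nX.
have Eg u : {subset unsign u <= unsign (x ++ y)} -> relabel g u = relabel f u.
  move=> Su; apply/eq_in_map => -[X t] /unsign_mem /Su Xc; rewrite /g /=.
  by case: eqP => // E; rewrite -E Xc in nA.
exists g; split.
- move=> X Y /Hxy HX /Hxy HY; rewrite /g; case: eqP HX => [-> _|/eqP nX /(_ isT) HX];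
    case: eqP HY => [-> _|/eqP nY /(_ isT) HY] // E.
  + by have := Lf _ HY; rewrite -E ltnn.
  + by have := Lf _ HX; rewrite E ltnn.
  + exact: If.
- by move=> X /Hxy HX; rewrite /g; case: eqP HX => // /eqP nX /(_ isT) /Lf /ltnW.
- have -> : relabel g ((A, s) :: x ++ (A, ~~ s) :: y) =
      (k, s) :: relabel f x ++ (k, ~~ s) :: relabel f y.
    rewrite {1}/relabel /= map_cat /= -!/(relabel g _) /g eqxx -/g !Eg //;
      by move=> X Xx; rewrite /unsign map_cat mem_cat Xx ?orbT.
  apply/flattenP; exists (insert_letter k s (relabel f (x ++ y))).
    by apply/allpairsPdep; exists (relabel f (x ++ y)), s; split=> //; case: (s).
  apply/mapP; exists (size x).
    by rewrite mem_iota /= add0n ltnS size_map size_cat leq_addr.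
  have -> : relabel f (x ++ y) = relabel f x ++ relabel f y by rewrite /relabel map_cat.
  have Sx : size x = size (relabel f x) by rewrite size_map.
  by rewrite take_size_cat // drop_size_cat.
Qed.

Lemma codes_checked k : k <= 4 -> all checked (codes k).
Proof. by case: k => [|[|[|[|[|k]]]]] //; vm_compute. Qed.

Lemma gauss_word_size w : gauss_word w -> size w = (size (undup w)).*2.
Proof.
move=> G; rewrite -{1}(perm_size (perm_count_undup w)) size_flatten /shape -map_comp.
have {G}: {in undup w, forall X, count_mem X w = 2}.
  by move=> X; rewrite mem_undup => /(allP G)/eqP.
elim: (undup w) => //= X u IH H; rewrite size_nseq H ?mem_head // IH // => Y Yu.
by apply: H; rewrite in_cons Yu orbT.
Qed.

Lemma size_nw_word n : size (nw_word n) = (crossings n).*2.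
Proof. exact/gauss_word_size/nw_gauss. Qed.

Lemma homotopic_tabulated k c : k <= 4 -> wf c -> size c = k.*2 ->
  exists t, [/\ List.In t table, crossings t <= k & homotopic (nano c) t].
Proof.
elim/ltn_ind: k c => k IH c k4 W Sc; have [f [If _ Ef]] := codes_complete W Sc.
have Wf := wf_relabel If W; have Hf := homotopic_nano W (CRelabel If).
have: simplifiable (relabel f c) by apply: checkedP Wf _; apply: (allP (codes_checked k4)).
rewrite /simplifiable size_map Sc => -[[d [Wd Sd Hd]]|[t [tT St Ht]]].
  pose j := crossings (nano d).
  have Sj : size d = j.*2 by rewrite -size_nw_word nw_word_nano // size_map.
  have jk : j < k by move: Sd; rewrite Sj ltn_double.
  have [|t [tT ct Ht]] := IH _ jk d _ Wd Sj; first exact: leq_trans (ltnW jk) k4.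
  exists t; split=> //; first exact: leq_trans ct (ltnW jk).
  exact: homotopic_trans Hf (homotopic_trans Hd Ht).
exists t; split=> //; last exact: homotopic_trans Hf Ht.
by rewrite -leq_double -size_nw_word St.
Qed.

Theorem homotopic_table n : crossings n <= 4 ->
  exists t, [/\ List.In t table, crossings t <= crossings n & homotopic n t].
Proof.
move=> n4; have [|t [tT ct Ht]] := homotopic_tabulated n4 (wf_code_of n).
  by rewrite size_code_of size_nw_word.
by exists t; split=> //; apply: homotopic_trans (homotopic_nano_code_of n) Ht.
Qed.

(** * Classification *)

Local Open Scope classical_set_scope.
Local Open Scope card_scope.

Lemma invariants_uniq : uniq [seq invariants n | n <- table].
Proof. by vm_compute. Qed.

Lemma map_In (T U : Type) (f : T -> U) (s : seq T) y :
  List.In y (map f s) -> exists x, List.In x s /\ f x = y.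
Proof.
elim: s => //= x s IH [<-|/IH[z [zs <-]]]; first by exists x; split; [left|].
by exists z; split; [right|].
Qed.

Lemma In_map (T U : Type) (f : T -> U) (s : seq T) x : List.In x s -> List.In (f x) (map f s).
Proof. by elim: s => //= y s IH [->|/IH]; [left|right]. Qed.

Lemma In_cat (T : Type) (s t : seq T) x : List.In x (s ++ t) <-> List.In x s \/ List.In x t.
Proof. by elim: s => /= [|y s [IH1 IH2]]; split; intuition. Qed.

Lemma In_mem (T : eqType) (s : seq T) x : List.In x s -> x \in s.
Proof. by elim: s => //= y s IH; rewrite in_cons => -[->|/IH ->]; rewrite ?eqxx ?orbT. Qed.

Lemma table_separated n m : List.In n table -> List.In m table -> homotopic n m -> n = m.
Proof.
move=> nT mT /homotopic_invariants; move: invariants_uniq nT mT.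
elim: table => //= x s IH /andP[xs U] [<-|ns] [<-|ms] // E.
- by move: (In_mem (In_map invariants ms)); rewrite -E (negPf xs).
- by move: (In_mem (In_map invariants ns)); rewrite E (negPf xs).
- exact: IH.
Qed.

Lemma homotopy_class_eq n m : homotopy_class n = homotopy_class m -> homotopic n m.
Proof.
by move=> E; have : homotopy_class m m := rst_refl _ _ m; rewrite -E.
Qed.

Lemma eq_homotopy_class n m : homotopic n m -> homotopy_class n = homotopy_class m.
Proof.
move=> H; apply/seteqP; split=> p /= Hp; first exact: homotopic_trans (homotopic_sym H) Hp.
exact: homotopic_trans H Hp.
Qed.

Lemma NoDup_homotopy_class (s : seq nanoword) :
  uniq (map invariants s) -> List.NoDup (map homotopy_class s).
Proof.
elim: s => [_|n s IH /= /andP[ns U]]; first exact: List.NoDup_nil.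
apply: List.NoDup_cons; last exact: IH.
move=> H; have [m [ms Em]] := map_In H; have E := homotopic_invariants (homotopy_class_eq Em).
by move: (In_mem (In_map invariants ms)); rewrite E (negPf ns).
Qed.

Lemma tabulated_crossings k n : List.In n (tabulated k) -> crossings n = k.
Proof.
have In_all (s : seq nanoword) : all (fun n => crossings n == k) s -> List.In n s -> crossings n = k.
  by elim: s => //= m s IH /andP[/eqP mk /IH H] [<-|/H].
by case: k In_all => [|[|[|[|[|k]]]]] In_all //; apply: In_all; vm_compute.
Qed.

Lemma tabulated_table k n : List.In n (tabulated k) -> List.In n table.
Proof.
have E : table = tabulated 0 ++ tabulated 3 ++ tabulated 4 by [].
case: k => [|[|[|[|[|k]]]]] // H; rewrite E; apply/In_cat.
- by left.
- by right; apply/In_cat; left.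
- by right; apply/In_cat; right.
Qed.

Lemma table_tabulated n : List.In n table -> List.In n (tabulated (crossings n)).
Proof.
have E : table = tabulated 0 ++ tabulated 3 ++ tabulated 4 by [].
by rewrite E => /In_cat[|/In_cat[]] H; rewrite (tabulated_crossings H).
Qed.

Lemma table_crossings n : List.In n table -> crossings n <= 4.
Proof.
move=> /table_tabulated; move: (crossings n) => k.
by case: k => [|[|[|[|[|k]]]]].
Qed.

(** A representative with fewer letters would reduce to another entry of the table. *)
Lemma homotopy_class_crossings n m : List.In n table -> homotopic n m -> crossings n <= crossings m.
Proof.
move=> nT H; case: (leqP (crossings n) (crossings m)) => // mn.
have [|t [tT tm Ht]] := @homotopic_table m.
  by apply: leq_trans (ltnW mn) _; apply: table_crossings.
have E : n = t by apply: table_separated => //; apply: homotopic_trans H Ht.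
by move: tm; rewrite -E leqNgt mn.
Qed.

Lemma min_crossing_number_table n : List.In n table ->
  min_crossing_number (homotopy_class n) (crossings n).
Proof.
move=> nT; split; first by exists n => //; apply: rst_refl.
by move=> m; apply: homotopy_class_crossings.
Qed.

Lemma virtual_string_table V k : virtual_string V -> min_crossing_number V k -> k <= 4 ->
  exists n, List.In n (tabulated k) /\ V = homotopy_class n.
Proof.
move=> [n0 _ <-] [[n Vn nk] Hk] k4.
have [|t [tT tn Ht]] := @homotopic_table n; first by rewrite nk.
have H0t : homotopic n0 t := homotopic_trans Vn Ht.
exists t; split; last exact: eq_homotopy_class.
suff <- : crossings t = k by apply: table_tabulated.
by apply/eqP; rewrite eqn_leq -{1}nk tn Hk.
Qed.

Lemma virtual_strings_tabulated k : k <= 4 ->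
  virtual_strings_of_crossing_number k = [set V | List.In V (map homotopy_class (tabulated k))].
Proof.
move=> k4; apply/seteqP; split=> V /= => [[Vs Vk]|/(@map_In _ _ homotopy_class)[n [nk <-]]].
  by have [n [nT ->]] := virtual_string_table Vs Vk k4; apply: In_map.
split; first by exists n.
by rewrite -(tabulated_crossings nk); apply/min_crossing_number_table/tabulated_table/nk.
Qed.

Lemma card_List_In (T : Type) (s : seq (set T)) : List.NoDup s -> [set x | List.In x s] #= `I_(size s).
Proof.
move=> U; rewrite card_eq_sym; apply/card_set_bijP; exists (nth set0 s); split.
- move=> i /= ; elim: s i {U} => //= x s IH [|i] Hi; [by left | by right; apply: IH].
- move=> i j; rewrite !inE /=; elim: s i j U => //= x s IH i j U.
  have [xs Us] : ~ List.In x s /\ List.NoDup s by move/List.NoDup_cons_iff: U.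
  have In_nth l : l < size s -> List.In (nth set0 s l) s.
    by elim: (s) l => //= y u IHu [|l] Hl; [left | right; apply: IHu].
  case: i j => [|i] [|j] //= Hi Hj E; first by case: xs; rewrite E; apply: In_nth.
    by case: xs; rewrite -E; apply: In_nth.
  by congr _.+1; apply: IH.
- move=> x /=; elim: s {U} => //= y s IH [->|/IH[i Hi <-]]; first by exists 0.
  by exists i.+1.
Qed.

Lemma tabulated_invariants_uniq k : uniq (map invariants (tabulated k)).
Proof.
have : table = tabulated 0 ++ tabulated 3 ++ tabulated 4 by [].
move=> E; move: invariants_uniq; rewrite E !map_cat !cat_uniq => /and3P[u0 _ /and3P[u3 _ u4]].
case: k => [|[|[|[|[|k]]]]]; [exact: u0 | exact: isT | exact: isT | exact: u3 | exact: u4 | exact: isT].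
Qed.

Lemma card_virtual_strings k : k <= 4 ->
  virtual_strings_of_crossing_number k #= `I_(size (tabulated k)).
Proof.
move=> k4; rewrite virtual_strings_tabulated // -(size_map homotopy_class).
apply/card_List_In/NoDup_homotopy_class.
exact: tabulated_invariants_uniq.
Qed.

Theorem mainTheorem1 :
  [/\ virtual_strings_of_crossing_number 0 #= `I_1,
      virtual_strings_of_crossing_number 1 #= `I_0,
      virtual_strings_of_crossing_number 2 #= `I_0,
      virtual_strings_of_crossing_number 3 #= `I_2 &
      virtual_strings_of_crossing_number 4 #= `I_26] /\
  [/\ size table = 29,
      (forall (k : nat) (n : nanoword), List.In n (tabulated k) ->
         min_crossing_number (homotopy_class n) k),
      List.NoDup (map homotopy_class table) &
      (forall (V : set nanoword) (k : nat),
         virtual_string V -> min_crossing_number V k -> k <= 4 ->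
         exists2 n : nanoword, List.In n table & V n)].
Proof.
split; first by split; apply: card_virtual_strings.
split=> // [k n nk||V k Vs Vk k4].
- by rewrite -(tabulated_crossings nk); apply/min_crossing_number_table/tabulated_table/nk.
- exact: NoDup_homotopy_class invariants_uniq.
- have [n [nk ->]] := virtual_string_table Vs Vk k4; exists n; first exact: tabulated_table nk.
  exact: rst_refl.
Qed.
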